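(* Let $(\mathcal{F},\tau)$ be a bornological locally convex Hausdorff space of $\mathbb{K}$-valued continuous functions on a non-empty topological Hausdorff space $\Omega$, and let $\mathcal{B}$ be the family of $\tau$-bounded sets. Consider: (a) $(\mathcal{F},\tau)$ admits a continuous strong complete barrelled linearisation. (b) There is a locally convex Hausdorff topology $\widetilde{\tau}$ on $\mathcal{F}$ with $\tau_{\mathrm{p}}\leq\widetilde{\tau}$ such that $(\mathcal{F},\tau)$ satisfies (BBC) and (CNC) for $\widetilde{\tau}$, and every $B\in\mathcal{B}$ is equicontinuous (as a family of functions on $\Omega$). (c) There is a locally convex Hausdorff topology $\widetilde{\tau}$ on $\mathcal{F}$ such that $(\mathcal{F},\tau)$ satisfies (BBC) and (CNC) for $\widetilde{\tau}$ and $\Delta\colon\Omega\to(\mathcal{F}_{\mathcal{B},\widetilde{\tau}}',\beta)$, $\Delta(x)=\delta_x$, is a well-defined continuous map. (d) There is a locally convex Hausdorff topology $\widetilde{\tau}$ on $\mathcal{F}$ with $\tau_{\mathrm{co}}\leq\widetilde{\tau}$ such that $(\mathcal{F},\tau)$ satisfies (BBC) and (CNC) for $\widetilde{\tau}$. Then (a), (b), (c) are equivalent. If $\Omega$ is a $gk_{\mathbb{R}}$-space, then (d) implies (c).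
   Context: $\mathbb{K}\in\{\mathbb{R},\mathbb{C}\}$. For an lcH space $Y$, $Y'$ is its dual and $Y_b'$ its strong dual. $\delta_x(f)=f(x)$; $\tau_{\mathrm{p}}$ is the topology of pointwise convergence and $\tau_{\mathrm{co}}$ the compact-open topology (uniform convergence on compact subsets of $\Omega$), restricted to $\mathcal{F}$. A linearisation of $\mathcal{F}$ is a triple $(\delta,Y,T)$ of an lcH space $Y$ over $\mathbb{K}$, a map $\delta\colon\Omega\to Y$ and an algebraic isomorphism $T\colon\mathcal{F}\to Y'$ with $T(f)\circ\delta=f$ for all $f$. It is strong if $T\colon(\mathcal{F},\tau)\to Y_b'$ is a topological isomorphism, complete barrelled if $Y$ is complete and barrelled, and continuous if $\delta$ is continuous. (BBC) for $\widetilde{\tau}$: every $\tau$-bounded set is contained in an absolutely convex $\tau$-bounded $\widetilde{\tau}$-compact set. (CNC) for $\widetilde{\tau}$: $\tau$ has a $0$-neighbourhood basis of absolutely convex $\widetilde{\tau}$-closed sets. $\mathcal{F}_{\mathcal{B},\widetilde{\tau}}'$ is the space of linear functionals on $\mathcal{F}$ whose restriction to each $\tau$-bounded set is $\widetilde{\tau}$-continuous, and $\beta$ is the topology on it of uniform convergence on $\tau$-bounded sets. A topological space $\Omega$ is a $gk_{\mathbb{R}}$-space if for every completely regular space $Z$, every map $f\colon\Omega\to Z$ whose restriction to each compact subset of $\Omega$ is continuous is continuous. *)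

(* Defs.v *)
(* Self-contained definitions of the
   locally convex notions used in Theorem 4.10 (several topologies on the same
   vector space are needed simultaneously, so topologies are represented
   explicitly by their filter of 0-neighbourhoods). *)
From HB Require Import structures.
From mathcomp Require Import all_boot all_order all_algebra.
From mathcomp Require Import all_classical all_reals all_analysis.
From mathcomp Require Import complex.
Set Implicit Arguments. Unset Strict Implicit. Unset Printing Implicit Defensive.
Import Order.TTheory GRing.Theory Num.Theory.
Local Open Scope classical_set_scope.
Local Open Scope ring_scope.

Section LocallyConvex.
Variables (K : numFieldType) (V : lmodType K).

Definition scale_set (a : K) (A : set V) : set V := [set a *: u | u in A].

Definition absconvex (A : set V) : Prop :=
  forall a b : K, `|a| + `|b| <= 1 ->
  forall u v, A u -> A v -> A (a *: u + b *: v).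

Definition absorbs (A B : set V) : Prop :=
  exists2 r : K, 0 < r & forall l : K, r <= `|l| -> B `<=` scale_set l A.

Definition absorbing (A : set V) : Prop := forall v, absorbs A [set v].

(* N is the filter of 0-neighbourhoods of a locally convex Hausdorff
   (vector space) topology on V. *)
Definition lcH_top (N : set (set V)) : Prop :=
  [/\ N setT,
      (forall U, N U -> U 0),
      (forall U W, N U -> U `<=` W -> N W),
      (forall U W, N U -> N W -> N (U `&` W)) &
   [/\ (forall U, N U -> absorbing U),
      (forall U, N U -> exists2 W, N W & W `<=` U /\ absconvex W),
      (forall U (a : K), N U -> a != 0 -> N (scale_set a U)) &
      (forall v, v != 0 -> exists2 U, N U & ~ U v)]].

Definition open_in (N : set (set V)) (O : set V) : Prop :=
  forall x, O x -> exists2 U, N U & forall y, U (y - x) -> O y.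

Definition closed_in (N : set (set V)) (A : set V) : Prop := open_in N (~` A).

Definition compact_in (N : set (set V)) (A : set V) : Prop :=
  forall C : set (set V), (forall O, C O -> open_in N O) ->
    A `<=` \bigcup_(O in C) O ->
    exists2 D : set (set V), finite_set D & D `<=` C /\ A `<=` \bigcup_(O in D) O.

Definition bounded_in (N : set (set V)) (B : set V) : Prop :=
  forall U, N U -> absorbs U B.

Definition bornological (N : set (set V)) : Prop :=
  forall A, absconvex A -> (forall B, bounded_in N B -> absorbs A B) -> N A.

Definition barrelled (N : set (set V)) : Prop :=
  forall A, absconvex A -> absorbing A -> closed_in N A -> N A.

Definition proper_filter (G : set (set V)) : Prop :=
  [/\ G setT, ~ G set0, (forall A B, G A -> G B -> G (A `&` B)) &
      (forall A B, G A -> A `<=` B -> G B)].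

Definition cauchy_filter (N : set (set V)) (G : set (set V)) : Prop :=
  proper_filter G /\
  forall U, N U -> exists2 A, G A & forall u v, A u -> A v -> U (u - v).

Definition converges_to (N : set (set V)) (G : set (set V)) (y : V) : Prop :=
  forall U, N U -> G [set u | U (u - y)].

Definition complete_lc (N : set (set V)) : Prop :=
  forall G, cauchy_filter N G -> exists y, converges_to N G y.

Definition linear_functional (phi : V -> K) : Prop :=
  forall (a : K) u v, phi (a *: u + v) = a * phi u + phi v.

Definition continuous_functional (N : set (set V)) (phi : V -> K) : Prop :=
  forall x (e : K), 0 < e ->
    exists2 U, N U & forall y, U (y - x) -> `|phi y - phi x| < e.

Definition BBC (N Nt : set (set V)) : Prop :=
  forall B, bounded_in N B ->
    exists A, [/\ B `<=` A, absconvex A, bounded_in N A & compact_in Nt A].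

Definition CNC (N Nt : set (set V)) : Prop :=
  forall U, N U -> exists W, [/\ N W, W `<=` U, absconvex W & closed_in Nt W].

Definition in_FBdual (N Nt : set (set V)) (phi : V -> K) : Prop :=
  linear_functional phi /\
  forall B, bounded_in N B -> forall f, B f -> forall e : K, 0 < e ->
    exists2 U, Nt U & forall g, B g -> U (g - f) -> `|phi g - phi f| < e.

End LocallyConvex.

Section FunctionSpace.
Variables (K : numFieldType) (Omega : topologicalType).

Definition Kcontinuous (h : Omega -> K) : Prop :=
  forall x (e : K), 0 < e -> \forall z \near x, `|h z - h x| < e.

Definition gkR_space : Prop :=
  forall (Z : topologicalType), completely_regular_space Z ->
  forall g : Omega -> Z,
    (forall C : set Omega, compact C -> {within C, continuous g}) ->
    continuous g.

Variables (V : lmodType K) (ev : V -> Omega -> K).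
(* V with the injective linear map ev is the function space F; ev f x = f(x) *)

Definition finer_than_pointwise (Nt : set (set V)) : Prop :=
  forall x (e : K), 0 < e -> Nt [set f | `|ev f x| < e].

Definition finer_than_compact_open (Nt : set (set V)) : Prop :=
  forall C : set Omega, compact C -> forall e : K, 0 < e ->
    Nt [set f | forall x, C x -> `|ev f x| < e].

Definition equicontinuous_set (B : set V) : Prop :=
  forall x (e : K), 0 < e ->
    \forall z \near x, forall f, B f -> `|ev f z - ev f x| < e.

(* Delta : Omega -> (F'_{B,tt}, beta), x |-> delta_x, is continuous; beta is the
   topology of uniform convergence on tau-bounded sets *)
Definition Delta_beta_continuous (N : set (set V)) : Prop :=
  forall x B, bounded_in N B -> forall e : K, 0 < e ->
    \forall z \near x, forall f, B f -> `|ev f z - ev f x| <= e.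

Definition has_cont_strong_cb_linearisation (N : set (set V)) : Prop :=
  exists (Y : lmodType K) (NY : set (set Y)) (delta : Omega -> Y)
         (T : V -> Y -> K),
  [/\ lcH_top NY,
      (forall f, linear_functional (T f) /\ continuous_functional NY (T f)),
      (forall (a : K) f g, T (a *: f + g) = (fun y => a * T f y + T g y)),
      injective T &
  [/\ (forall phi : Y -> K, linear_functional phi ->
         continuous_functional NY phi -> exists f, T f = phi),
      (forall f x, T f (delta x) = ev f x),
      (* strong: T : (F,tau) -> Y'_b is a homeomorphism *)
      (forall U, N U <-> exists2 B, bounded_in NY B &
                     [set f | forall y, B y -> `|T f y| <= 1] `<=` U),
      complete_lc NY /\ barrelled NY &
      (forall x U, NY U -> \forall z \near x, U (delta z - delta x))]].

End FunctionSpace.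

Definition Thm4p10_for (K : numFieldType) : Prop :=
  forall (Omega : topologicalType), hausdorff_space Omega -> (exists x : Omega, True) ->
  forall (V : lmodType K) (ev : V -> Omega -> K),
    (forall (a : K) f g x, ev (a *: f + g) x = a * ev f x + ev g x) ->
    injective ev ->
    (forall f, Kcontinuous (ev f)) ->
  forall N : set (set V), lcH_top N -> bornological N ->
  let Sa := has_cont_strong_cb_linearisation ev N in
  let Sb := exists Nt, [/\ lcH_top Nt, finer_than_pointwise ev Nt,
                BBC N Nt, CNC N Nt &
                forall B, bounded_in N B -> equicontinuous_set ev B] in
  let Sc := exists Nt, [/\ lcH_top Nt, BBC N Nt, CNC N Nt,
                (forall x, in_FBdual N Nt (fun f => ev f x)) &
                Delta_beta_continuous ev N] in
  let Sd := exists Nt, [/\ lcH_top Nt, finer_than_compact_open ev Nt,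
                BBC N Nt & CNC N Nt] in
  [/\ Sa <-> Sb, Sb <-> Sc & (gkR_space Omega -> Sd -> Sc)].

(* Main.v *)
Require Import Defs.
From HB Require Import structures.
From mathcomp Require Import all_boot all_order all_algebra.
From mathcomp Require Import all_classical all_reals all_analysis.
From mathcomp Require Import complex.
From mathcomp Require Import ring lra.
Set Implicit Arguments. Unset Strict Implicit. Unset Printing Implicit Defensive.
Import Order.TTheory GRing.Theory Num.Theory.
Import numFieldNormedType.Exports.
Local Open Scope classical_set_scope.
Local Open Scope ring_scope.

(* In (a) => (b), the topology tt on F is the weak topology transported
   from Y' by T: bounded sets of F are equicontinuous because Y is barrelled, so
   (BBC) is Alaoglu-Bourbaki. For (c) => (a) the predual is Y = F'_{B,tt} with
   beta. By (BBC) the polars of compact discs are a basis of beta, so a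
   compactness argument of Mackey-Arens type gives Y' = F; by (CNC) and
   Hahn-Banach in (F,tt) the strong topology of F = Y' is tau. Given a barrel D of
   Y, its polar in F is pointwise bounded on Y; as Y is complete, a gliding hump
   on the polar of each neighbourhood of F shows that it is tau-bounded, and D is
   the polar of that bounded set. For (d), the functions
   z |-> sup_{f in B} min(1, |f z - f x|) are continuous on compact sets. *)

(** Norms in [K] are elements of [K], whose order is only partial for complex scalars. Suprema,
    infima and gauges are therefore formed in [R] and transported by [j], and completeness of [K]
    enters as convergence of bounded scalars along ultrafilters. Compactness, given by open covers,
    is put into the same form. The hard step is that the predual is barrelled. The bornological
    hypothesis serves another purpose: it makes polars of [beta]-bounded sets [tau]-neighbourhoods.
    Barrelledness rests on a uniform boundedness principle on the polars of neighbourhoods of F,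
    which are Banach discs because [beta] is complete. The hump runs on points of [Y] itself, so
    neither a normed space spanned by a disc nor a category argument has to be set up. Its steps
    have ratio 1/3: all later steps together make half of the current one, and if the current one is
    taken in a direction where the functional attains its supremum up to the factor 3/2, a share 1 -
    3/4 = 1/4 of the hump survives. *)

(* What the proof needs of K, with R embedded by j: for K = R, j is the identity,
   for K = R[i] the inclusion. By scal_lift a real-linear functional rho is
   the real part of a K-linear one, up to a rotation c of the argument. *)
Record scalar_field (R : realType) (K : numFieldType) (j : {rmorphism R -> K}) :
    Prop := ScalarField {
  scal_le : {mono j : x y / x <= y};
  scal_nneg : forall z : K, 0 <= z -> exists r, z = j r;
  scal_ultra : forall (X : Type) (G : set_system X) (h : X -> K) (M : K),
    UltraFilter G -> G [set x | `|h x| <= M] ->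
    exists y, forall e, 0 < e -> G [set x | `|h x - y| < e];
  scal_lift : forall (V : lmodType K) (rho : V -> R),
    {morph rho : u v / u + v} -> (forall t v, rho (j t *: v) = t * rho v) ->
    exists phi : V -> K, [/\ linear_functional phi,
      forall v, j (rho v) <= `|phi v| &
      forall v, exists2 c, `|c| <= 1 & `|phi v| = j (rho (c *: v))] }.

(** By compactness of [[- M, M]] the image of [G] clusters at some point, and a cluster point of an
    ultrafilter is a limit. *)
Lemma real_ultra_cvg (R : realType) (X : Type) (G : set_system X) (h : X -> R)
    (M : R) : UltraFilter G -> G [set x | `|h x| <= M] ->
  exists y, forall e, 0 < e -> G [set x | `|h x - y| < e].
Proof.
move=> UG GM.
have GP : ProperFilter (h @ G) by apply: fmap_proper_filter.
have : G (h @^-1` `[- M, M]%classic).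
  by apply: filterS GM => x /= hM; rewrite in_itv /= -ler_norml.
move=> /(@segment_compact R (- M) M _ GP)[y [_ clY]].
exists y => e e0.
have [//|Gn] := in_ultra_setVsetC [set x | `|h x - y| < e] UG.
have [z [/= nz yz]] := clY (~` [set z | `|z - y| < e]) (ball y e) Gn
  (nbhsx_ballx y e e0).
by case: nz; rewrite distrC.
Qed.

Lemma scalar_field_real (R : realType) :
  scalar_field (idfun : {rmorphism R -> R}).
Proof.
split=> //.
- by move=> z _; exists z.
- exact: real_ultra_cvg.
- move=> V rho rhoD rhoZ; exists rho; split=> [a u v|v|v].
  + by rewrite rhoD rhoZ.
  + exact: ler_norm.
  + have [r0|r0] := leP 0 (rho v).
      by exists 1; rewrite ?normr1// scale1r /= ger0_norm.
    exists (-1); first by rewrite normrN normr1.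
    by rewrite (rhoZ (-1)) /= ltr0_norm // mulN1r.
Qed.

Lemma scalar_field_complex (R : realType) :
  scalar_field (real_complex R : {rmorphism R -> R[i]}).
Proof.
have normRe (z : R[i]) : `|complex.Re z| <= complex.Re `|z|.
  by rewrite normc_def /= -sqrtr_sqr ler_sqrt ?addr_ge0 ?sqr_ge0// lerDl sqr_ge0.
have normIm (z : R[i]) : `|complex.Im z| <= complex.Re `|z|.
  by rewrite normc_def /= -sqrtr_sqr ler_sqrt ?addr_ge0 ?sqr_ge0// lerDr sqr_ge0.
have ReK (z : R[i]) : 0 <= z -> (complex.Re z)%:C%C = z.
  by move=> z0; rewrite RRe_real // ger0_real.
split.
- by move=> x y; rewrite lecR.
- by move=> z /ReK <-; exists (complex.Re z).
- move=> X G h M UG GM.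
  have Re_le (z w : R[i]) : z <= w -> complex.Re z <= complex.Re w.
    by rewrite lecE => /andP[].
  have [|a ha] :=
    @real_ultra_cvg R X G (fun x => complex.Re (h x)) (complex.Re M) UG.
    by apply: filterS GM => x /= /Re_le; apply: le_trans; exact: normRe.
  have [|b hb] :=
    @real_ultra_cvg R X G (fun x => complex.Im (h x)) (complex.Re M) UG.
    by apply: filterS GM => x /= /Re_le; apply: le_trans; exact: normIm.
  exists (a +i* b)%C => e e0.
  have r0 : 0 < complex.Re e by rewrite -ltcR ReK // ltW.
  have {}r0 : 0 < complex.Re e / 2 by rewrite divr_gt0.
  apply: filterS (filterI (ha _ r0) (hb _ r0)) => x /= [Hre Him].
  rewrite (complexE (h x - _)) (le_lt_trans (ler_normD _ _)) //.
  have -> : e = (complex.Re e / 2)%:C%C + (complex.Re e / 2)%:C%C.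
    by rewrite -{1}(ReK e (ltW e0)) [in LHS](splitr (complex.Re e)) rmorphD.
  have i1 : `|'i%C| = 1 :> R[i].
    by rewrite normc_def /= expr0n /= add0r expr1n sqrtr1.
  have nR (t : R) : `|t%:C%C| = `|t|%:C%C :> R[i].
    by rewrite normc_def /= expr0n /= addr0 sqrtr_sqr.
  rewrite normrM i1 mul1r !nR ltrD // ltcR.
    by case: (h x) Hre.
  by case: (h x) Him.
- move=> V rho rhoD rhoZ.
  have rho0 : rho 0 = 0 by have := rhoZ 0 0; rewrite rmorph0 scale0r mul0r.
  have rhoN v : rho (- v) = - rho v.
    by have := rhoZ (-1) v; rewrite rmorphN1 scaleN1r mulN1r.
  (* The classical complexification [rho v - i rho (i v)], the only complex-linear functional with
     real part [rho]. *)
  pose phi v : R[i] := (rho v +i* (- rho ('i%C *: v)))%C.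
  have phiD u v : phi (u + v) = phi u + phi v.
    by rewrite /phi scalerDr !rhoD opprD; simpc.
  have phiZ a v : phi (a *: v) = a * phi v.
    rewrite /phi (complexE a) scalerA mulrDr mulrA -expr2 sqr_i mulN1r.
    rewrite !scalerDl scaleNr ![('i * _)%C]mulrC -!scalerA !rhoD rhoN !rhoZ.
    by simpc; congr Complex; rewrite ?opprB // addrC.
  exists phi; split.
  + by move=> a u v; rewrite phiD phiZ.
  + move=> v; rewrite -[`|_|]ReK ?normr_ge0// lecR.
    by apply: le_trans (normRe _); exact: ler_norm.
  + move=> v; have [p0|p0] := eqVneq (phi v) 0.
      by exists 0; rewrite ?normr0 // scale0r rho0 p0 normr0.
    (* This rotation makes [phi (c *: v)] equal to [|phi v|]; being real, it equals its real part
       [rho (c *: v)]. *)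
    exists (`|phi v| / phi v).
      by rewrite normf_div normr_id divff // normr_eq0.
    have := phiZ (`|phi v| / phi v) v.
    rewrite divfK // => H.
    by rewrite -[LHS]ReK ?normr_ge0 // -[in LHS]H.
Qed.

(** * Hahn-Banach *)

Section HahnBanach.
Variables (R : realType) (K : numFieldType) (j : {rmorphism R -> K}).
Variable V : lmodType K.

Definition sublinear (p : V -> R) :=
  (forall u v, p (u + v) <= p u + p v) /\
  (forall t v, 0 < t -> p (j t *: v) = t * p v).

Lemma sublinear0 p : sublinear p -> p 0 = 0.
Proof. by case=> _ /(_ 2 0 ltac:(by [])); rewrite scaler0; lra. Qed.

Lemma sublinear_lb p u : sublinear p -> - p (- u) <= p u.
Proof.
by move=> sp; have := sp.1 u (- u); rewrite subrr (sublinear0 sp); lra.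
Qed.

(** Stated with an auxiliary index [k] to serve two families: the shifts below, where [k] is a sum
    of parameters, and chains in Zorn's lemma, where [k] is the smaller functional. One inequality
    of homogeneity suffices, as the other follows from it for [t^-1]. *)
Lemma inf_sublinear (I : Type) (D : set I) (F : I -> V -> R) :
  D !=set0 ->
  (forall u, exists b, forall i, D i -> b <= F i u) ->
  (forall i i', D i -> D i' -> exists2 k, D k &
     forall u v, F k (u + v) <= F i u + F i' v) ->
  (forall t i, 0 < t -> D i -> exists2 k, D k &
     forall u, F k (j t *: u) <= t * F i u) ->
  exists q, [/\ sublinear q, forall i u, D i -> q u <= F i u &
    forall u b, (forall i, D i -> b <= F i u) -> b <= q u].
Proof.
move=> [i0 Di0] lbF addF scaF.
pose q u := inf [set F i u | i in D].
have qF i u : D i -> q u <= F i u.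
  move=> Di; have [b Fb] := lbF u; apply: ge_inf; last by exists i.
  by exists b => _ [k Dk <-]; exact: Fb.
have bq u b : (forall i, D i -> b <= F i u) -> b <= q u.
  move=> Fb; apply: lb_le_inf; first by exists (F i0 u), i0.
  by move=> _ [k Dk <-]; exact: Fb.
have qD u v : q (u + v) <= q u + q v.
  rewrite -lerBlDr; apply: (bq u _) => i Di; rewrite lerBlDl -lerBlDr.
  apply: (bq v _) => k Dk; rewrite lerBlDl.
  have [l Dl Fl] := addF _ _ Di Dk.
  exact: le_trans (qF _ _ Dl) (Fl _ _).
have qZ t u : 0 < t -> q (j t *: u) <= t * q u.
  move=> t0; rewrite mulrC -ler_pdivrMr //; apply: (bq u _) => i Di.
  rewrite ler_pdivrMr // mulrC.
  by have [k Dk Fk] := scaF _ _ t0 Di; exact: le_trans (qF _ _ Dk) (Fk _).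
exists q; split=> //; split=> // t u t0; apply/eqP; rewrite eq_le qZ //=.
have := qZ t^-1 (j t *: u); rewrite invr_gt0 => /(_ t0).
rewrite scalerA -rmorphM mulVf ?gt_eqF // rmorph1 scale1r => H.
by rewrite mulrC -ler_pdivlMr // mulrC.
Qed.

(** Here [q u] is the infimum of [p (u + t v) - t p v] over [t >= 0]; the values [t = 0] and [t = 1]
    give the two bounds. If [q = p], the second bound is superadditivity at [v]. *)
Lemma sublinear_shift p v : sublinear p ->
  exists q, [/\ sublinear q, forall u, q u <= p u &
    forall u, q u <= p (u + v) - p v].
Proof.
move=> sp; have [pD pZ] := sp.
have pZ0 t w : 0 <= t -> p (j t *: w) = t * p w.
  rewrite le_eqVlt => /predU1P[<-|/pZ//].
  by rewrite rmorph0 scale0r mul0r sublinear0.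
have [|||| q [sq qF _]] := @inf_sublinear R [set t | 0 <= t]
    (fun t u => p (u + j t *: v) - t * p v).
- by exists 0 => /=.
- move=> u; exists (- p (- u)) => t t0.
  have := pD (u + j t *: v) (- u); rewrite addrAC subrr add0r pZ0 //; lra.
- move=> s t s0 t0; exists (s + t); first exact: addr_ge0.
  move=> u w; have := pD (u + j s *: v) (w + j t *: v).
  by rewrite rmorphD scalerDl addrACA; lra.
- move=> s t s0 t0; exists (s * t); first exact: mulr_ge0 (ltW s0) t0.
  by move=> u; rewrite rmorphM -scalerA -scalerDr pZ // mulrBr mulrA.
exists q; split=> // u.
- by have := qF 0 u (lexx 0); rewrite rmorph0 scale0r addr0 mul0r subr0.
- by have := qF 1 u ler01; rewrite rmorph1 scale1r mul1r.
Qed.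

(* A minimal sublinear functional is linear, because the shift of
   sublinear_shift cannot decrease it. *)
Lemma hahn_banach p v0 : sublinear p ->
  exists rho : V -> R, [/\ {morph rho : u v / u + v},
    forall t v, rho (j t *: v) = t * rho v,
    forall v, rho v <= p v & p v0 <= rho v0].
Proof.
(* Zorn's lemma is applied below the shift [p1], not below [p]: since [p1 (- v0) <= - p v0], any
   linear functional under [p1] attains [p] at [v0]. *)
move=> sp; have [p1 [sp1 p1p p1v0]] := sublinear_shift v0 sp.
pose T := {q : V -> R | sublinear q /\ forall u, q u <= p1 u}.
pose le_T (s t : T) := `[< forall u, sval t u <= sval s u >].
have [||A Atot|[q [sq qp1]] qmin] := @ZL_preorder T
    (exist _ p1 (conj sp1 (fun=> lexx _))) le_T.
- by move=> t; apply/asboolP.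
- move=> r s t /asboolP rs /asboolP st; apply/asboolP => u.
  exact: le_trans (st u) (rs u).
- have [[t0 At0]|A0] := pselect (A !=set0); last first.
    exists (exist _ p1 (conj sp1 (fun=> lexx _))) => s As.
    by case: A0; exists s.
  have [|||| q [sq qA qlb]] := @inf_sublinear T A (fun t => sval t).
  + by exists t0.
  + move=> u; exists (- p1 (- u)) => -[q [sq qp1]] _ /=.
    by apply: le_trans (sublinear_lb u sq); rewrite lerN2.
  + move=> s t As At; have [/asboolP st|/asboolP ts] := Atot s t As At.
      exists t => // u v; apply: le_trans ((svalP t).1.1 u v) _.
      exact: lerD.
    exists s => // u v; apply: le_trans ((svalP s).1.1 u v) _.
    exact: lerD.
  + by move=> t s t0' As; exists s => // u; rewrite (svalP s).1.2.
  have qp1 u : q u <= p1 u by apply: le_trans (qA _ _ At0) ((svalP t0).2 u).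
  by exists (exist _ q (conj sq qp1)) => s As; apply/asboolP => u; exact: qA.
have {}qmin q' : sublinear q' -> (forall u, q' u <= q u) -> q' = q.
  move=> sq' q'q.
  have q'p1 u : q' u <= p1 u by exact: le_trans (q'q u) (qp1 u).
  have /asboolP H := qmin (exist _ q' (conj sq' q'p1)) (asboolT q'q).
  by apply/funext => u; apply/eqP; rewrite eq_le q'q (H u).
have qD : {morph q : u v / u + v}.
  move=> u v; apply/eqP; rewrite eq_le sq.1 /=.
  have [q' [sq' q'q q'v]] := sublinear_shift v sq.
  by have := q'v u; rewrite (qmin _ sq' q'q); lra.
have qN v : q (- v) = - q v.
  by have := qD v (- v); rewrite subrr (sublinear0 sq); lra.
exists q; split=> //.
- move=> t v; have [t0|t0|->] := ltgtP t 0; first 1 last.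
  + exact: sq.2.
  + by rewrite rmorph0 scale0r mul0r (sublinear0 sq).
  + have /(sq.2 _ v) : 0 < - t by rewrite oppr_gt0.
    by rewrite rmorphN scaleNr qN; lra.
- by move=> v; apply: le_trans (qp1 v) (p1p v).
- have := le_trans (qp1 (- v0)) (p1v0 (- v0)).
  by rewrite addNr (sublinear0 sp) qN; lra.
Qed.

End HahnBanach.

Section LinearFunctional.
Variables (K : numFieldType) (V : lmodType K) (phi : V -> K).
Hypothesis lphi : linear_functional phi.

Lemma lf0 : phi 0 = 0.
Proof. by have := lphi (-1) 0 0; rewrite scaler0 addr0 mulN1r addNr. Qed.

Lemma lfZ a u : phi (a *: u) = a * phi u.
Proof. by rewrite -[a *: u]addr0 lphi lf0 addr0. Qed.

Lemma lfD u v : phi (u + v) = phi u + phi v.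
Proof. by rewrite -{1}[u]scale1r lphi mul1r. Qed.

Lemma lfB u v : phi (u - v) = phi u - phi v.
Proof. by rewrite -scaleN1r lfD lfZ mulN1r. Qed.

End LinearFunctional.

(** * Absolutely convex sets, polars and separation *)

Section AbsConvex.
Variables (K : numFieldType) (V : lmodType K).
Implicit Types (A B U W : set V).

Lemma absconvexZ A a u : absconvex A -> `|a| <= 1 -> A u -> A (a *: u).
Proof.
move=> cA a1 Au; have := cA a 0 _ u u Au Au.
by rewrite scale0r addr0 normr0 addr0; apply.
Qed.

Lemma scale_setP (a : K) A u : a != 0 -> scale_set a A u <-> A (a^-1 *: u).
Proof.
move=> a0; split=> [[v Av <-]|Au]; first by rewrite scalerA mulVf // scale1r.
by exists (a^-1 *: u) => //; rewrite scalerA divff // scale1r.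
Qed.

(** The form with small scalars. The scalar 0 is left out because [absorbs] does not force [A] to
    contain 0. *)
Lemma absorbsP A B : absorbs A B <->
  exists2 r : K, 0 < r & forall a, 0 < `|a| -> `|a| <= r ->
    forall u, B u -> A (a *: u).
Proof.
split=> -[r r0 AB]; exists r^-1; rewrite ?invr_gt0 //.
- move=> a a0 ar u Bu.
  have an0 : a != 0 by rewrite -normr_gt0.
  have := AB a^-1 _ u Bu; rewrite normfV.
  move=> /(_ _)/scale_setP; rewrite invrK invr_eq0; apply=> //.
  by rewrite -[r]invrK lef_pV2 // posrE invr_gt0.
- move=> l rl u Bu; have l0 : 0 < `|l| by apply: lt_le_trans rl; rewrite invr_gt0.
  have ln0 : l != 0 by rewrite -normr_gt0.
  apply/scale_setP => //; apply: AB => //; rewrite normfV ?invr_gt0 //.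
  by rewrite -[r]invrK lef_pV2 // posrE invr_gt0.
Qed.

(** No structure is put on [X], so that polars in F, polars in the predual and polydiscs in [K^n]
    are all instances. *)
Definition polar_in (X : Type) (b : X -> V -> K) (S : set X) (e : K) : set V :=
  [set v | forall x, S x -> `|b x v| <= e].

Lemma polar_absconvex (X : Type) (b : X -> V -> K) S e :
  (forall x, linear_functional (b x)) -> absconvex (polar_in b S e).
Proof.
move=> lb a c ac u v Su Sv x Sx.
rewrite lb lfZ //; apply: le_trans (ler_normD _ _) _; rewrite !normrM.
have e0 : 0 <= e by apply: le_trans (Su x Sx).
apply: le_trans (_ : `|a| * e + `|c| * e <= _).
  by rewrite lerD // ler_wpM2l // ?Su ?Sv.
by rewrite -mulrDl ler_piMl.
Qed.

End AbsConvex.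

Section Separation.
Variables (R : realType) (K : numFieldType) (j : {rmorphism R -> K}).
Hypothesis KS : scalar_field j.

Let j0 r : (0 <= j r) = (0 <= r).
Proof. by rewrite -[in LHS](rmorph0 j) (scal_le KS). Qed.

Let jp r : (0 < j r) = (0 < r).
Proof. by rewrite !lt_neqAle j0 ![0 == _]eq_sym fmorph_eq0. Qed.

Let jn r : 0 <= r -> `|j r| = j r.
Proof. by move=> r0; rewrite ger0_norm // j0. Qed.

Lemma scal_ler1 r : (j r <= 1) = (r <= 1).
Proof. by rewrite -[in LHS](rmorph1 j) (scal_le KS). Qed.

Variable V : lmodType K.
Implicit Types (S U W : set V).

(** The Minkowski gauge, with dilations by positive reals only, so that the infimum lies in [R]. The
    last clause lets the separation conclude that a point outside a proper shrinking of [S] has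
    gauge above 1. *)
Lemma gauge_sublinear S : absconvex S -> absorbing S ->
  exists p : V -> R, [/\ sublinear j p, forall v, S v -> p v <= 1 &
    forall v r, (forall t, 0 < t -> S (j t^-1 *: v) -> r <= t) -> r <= p v].
Proof.
move=> cS aS; pose D v := [set t : R | 0 < t /\ S (j t^-1 *: v)].
pose p v := inf (D v).
have Dlb v : lbound (D v) 0 by move=> t [/ltW].
have D0 v : D v !=set0.
  have /absorbsP[r r0 Sr] := aS v.
  have [s rs] := scal_nneg KS (ltW r0); rewrite rs jp in r0.
  exists s^-1; split; first by rewrite invr_gt0.
  by rewrite invrK; apply: Sr; rewrite // jn ?(ltW r0) ?jp ?rs.
have pD v t : 0 < t -> S (j t^-1 *: v) -> p v <= t.
  by move=> t0 Sv; apply: ge_inf; [exists 0; exact: Dlb | split].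
have Dp v r : (forall t, 0 < t -> S (j t^-1 *: v) -> r <= t) -> r <= p v.
  by move=> H; apply: lb_le_inf => // t [t0 St]; exact: H.
have pZ t v : 0 < t -> p (j t *: v) <= t * p v.
  move=> t0; rewrite mulrC -ler_pdivrMr //; apply: Dp => s s0 Sv.
  rewrite ler_pdivrMr //; apply: pD; first exact: mulr_gt0.
  by rewrite scalerA -rmorphM invfM -mulrA mulVf ?gt_eqF // mulr1.
exists p; split=> //; last first.
  by move=> v Sv; apply: pD; rewrite // invr1 rmorph1 scale1r.
split=> [u v|t v t0].
- rewrite -lerBlDr; apply: (Dp u) => s s0 Su; rewrite lerBlDl -lerBlDr.
  apply: (Dp v) => t t0 Sv; rewrite lerBlDr; apply: pD; first exact: addr_gt0.
  have st0 : 0 < t + s by exact: addr_gt0.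
  have -> : j (t + s)^-1 *: (u + v) =
      j (s / (t + s)) *: (j s^-1 *: u) + j (t / (t + s)) *: (j t^-1 *: v).
    rewrite scalerDr !scalerA -!rmorphM; congr (j _ *: _ + j _ *: _).
    by rewrite mulrAC divff ?gt_eqF // mul1r.
    by rewrite mulrAC divff ?gt_eqF // mul1r.
  apply: cS => //.
  rewrite !jn ?divr_ge0 ?(ltW s0) ?(ltW t0) ?(ltW st0) //.
  by rewrite -rmorphD -mulrDl addrC divff ?gt_eqF // rmorph1 lexx.
- apply/eqP; rewrite eq_le pZ //=.
  have := pZ t^-1 (j t *: v); rewrite invr_gt0 => /(_ t0).
  rewrite scalerA -rmorphM mulVf ?gt_eqF // rmorph1 scale1r => H.
  by rewrite mulrC -ler_pdivlMr // mulrC.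
Qed.

(** Hahn-Banach for the gauge of [W + U / 2]. Only half of [U] is added, so that even a slightly
    shrunk [v0] stays outside and the gauge at [v0] is strictly above 1; this halving also causes
    the bound 2 on [U]. *)
Lemma absconvex_separation W U v0 : absconvex W -> absconvex U -> W 0 ->
  absorbing U -> (forall u, U u -> ~ W (v0 + u)) ->
  exists phi : V -> K, [/\ linear_functional phi,
    forall w, W w -> `|phi w| <= 1, forall u, U u -> `|phi u| <= 2 &
    1 < `|phi v0|].
Proof.
move=> cW cU W0 aU disj.
have h2 : `|2^-1| = 2^-1 :> K by rewrite ger0_norm // invr_ge0.
have hh : 2^-1 + 2^-1 = 1 :> K by rewrite [RHS]splitr !div1r.
have /absorbsP[k k0 Uk] := aU v0.
have U0 : U 0.
  have /absorbsP[r r0 Ur] := aU 0.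
  by rewrite -(scaler0 _ r); apply: Ur; rewrite ?ger0_norm ?(ltW r0).
pose S := [set w + 2^-1 *: u | w in W & u in U].
have WS w : W w -> S w.
  by move=> Ww; exists w => //; exists 0; rewrite // scaler0 addr0.
have US u : U u -> S (2^-1 *: u).
  by move=> Uu; exists 0 => //; exists u; rewrite // add0r.
have cS : absconvex S.
  move=> a b ab _ _ [w1 Ww1 [u1 Uu1 <-]] [w2 Ww2 [u2 Uu2 <-]].
  exists (a *: w1 + b *: w2); first exact: cW.
  exists (a *: u1 + b *: u2); first exact: cU.
  by rewrite !scalerDr addrACA !scalerA ![2^-1 * _]mulrC.
have aS : absorbing S.
  move=> v; have /absorbsP[r r0 Ur] := aU v; apply/absorbsP.
  exists (2^-1 * r); first by rewrite mulr_gt0 // invr_gt0.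
  move=> a a0 ar _ ->; rewrite -[a]mul1r -(@mulVf _ 2) // -mulrA -scalerA.
  apply: US; apply: Ur => //; rewrite normrM ger0_norm // ?mulr_gt0 //.
  by rewrite -ler_pdivlMl.
have [p [sp pS Sp]] := gauge_sublinear cS aS.
have [k' kk] := scal_nneg KS (ltW k0).
have k0' : 0 < k' by rewrite -jp -kk.
(* With this [s], [2 s v0] lies in [U]. If [(1 - s) v0 = w + u / 2], then
   [v0 = w + (u + 2 s v0) / 2], and [v0] would differ from a point of [W] by an element of [U]. *)
pose s : R := Num.min k' 1 / 2.
have s0 : 0 < s by rewrite divr_gt0 // lt_min k0' ltr01.
have s1 : s < 1 by rewrite /s ltr_pdivrMr // gt_min; apply/orP; right; lra.
have s2k : s * 2 <= k' by rewrite /s divfK // ge_min lexx.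
have nS : ~ S (j (1 - s) *: v0).
  move=> [w Ww [u Uu E]].
  have Us : U (j (s * 2) *: v0).
    have s20 : 0 < s * 2 by exact: mulr_gt0.
    by apply: Uk; rewrite // (jn (ltW s20)) ?jp // kk (scal_le KS).
  pose u' : V := - (2^-1 *: u + 2^-1 *: (j (s * 2) *: v0)).
  apply: (disj u').
    rewrite /u' opprD -!scaleNr; apply: cU => //.
    by rewrite normrN h2 hh.
  have E1 : v0 = j (1 - s) *: v0 + j s *: v0.
    by rewrite -scalerDl -rmorphD subrK rmorph1 scale1r.
  have E2 : 2^-1 *: (j (s * 2) *: v0) = j s *: v0.
    by rewrite scalerA rmorphM rmorph_nat mulrC -mulrA divff // mulr1.
  by rewrite /u' E2 {1}E1 -E opprD addrACA addrK subrr addr0.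
have pv0 : 1 < p v0.
  apply: lt_le_trans (_ : (1 - s)^-1 <= _).
    by rewrite invf_gt1 ?subr_gt0 // gtrBl.
  apply: Sp => t t0 St; rewrite leNgt; apply/negP => tlt; apply: nS.
  have st : (1 - s) * t <= 1.
    by rewrite -ler_pdivlMl ?subr_gt0 // mulr1 ltW.
  have := absconvexZ (a := j ((1 - s) * t)) cS _ St.
  rewrite scalerA -rmorphM -mulrA divff ?gt_eqF // mulr1; apply.
  by rewrite jn ?scal_ler1 // mulr_ge0 ?subr_ge0 ?ltW.
have [rho [rhoD rhoZ rhop rho0]] := hahn_banach v0 sp.
have [phi [lphi rphi phir]] := scal_lift KS rhoD rhoZ.
have phiS v : S v -> `|phi v| <= 1.
  move=> Sv; have [c c1 ->] := phir v; rewrite scal_ler1.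
  by apply: le_trans (rhop _) _; apply: pS; exact: absconvexZ.
exists phi; split=> //.
- by move=> w /WS/phiS.
- move=> u /US/phiS; rewrite lfZ // normrM h2.
  by rewrite ler_pdivrMl // mulr1.
- apply: lt_le_trans (rphi v0); rewrite -(rmorph1 j) lt_neqAle.
  rewrite (scal_le KS) (ltW (lt_le_trans pv0 rho0)) andbT.
  by rewrite (inj_eq (fmorph_inj j)) lt_eqF // (lt_le_trans pv0 rho0).
Qed.

End Separation.

(** * Locally convex topologies *)

Lemma filter_finite_bigcap (I : choiceType) (X : Type) (F : set_system X)
    (D : set I) (A : I -> set X) : Filter F -> finite_set D ->
  (forall i, D i -> F (A i)) -> F (\bigcap_(i in D) A i).
Proof.
move=> FF /finite_fsetP[s ->] FA; apply: filter_bigI => i si; exact: FA.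
Qed.

Lemma pos_common_lb (K : numFieldType) (e d : K) : 0 < e -> 0 < d ->
  exists c, [/\ 0 < c, c <= e & c <= d].
Proof.
move=> e0 d0; have /orP[ed|de] := real_leVge (gtr0_real e0) (gtr0_real d0).
  by exists e.
by exists d.
Qed.

Section Topology.
Variables (K : numFieldType) (V : lmodType K) (N : set (set V)).
Hypothesis lcN : lcH_top N.
Implicit Types (A B U W : set V) (phi : V -> K).

Lemma lcHT : N setT. Proof. by case: lcN. Qed.

Lemma lcH0 U : N U -> U 0. Proof. by case: lcN => _ + _ _ _; apply. Qed.

Lemma lcHS U W : U `<=` W -> N U -> N W.
Proof. by case: lcN => _ _ H _ _ UW NU; exact: H UW. Qed.

Lemma lcHI U W : N U -> N W -> N (U `&` W).
Proof. by case: lcN => _ _ _ + _; apply. Qed.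

Lemma lcH_absorbing U : N U -> absorbing U.
Proof. by case: lcN => _ _ _ _ [+ _ _ _]; apply. Qed.

Lemma lcH_absconvex U : N U -> exists2 W, N W & W `<=` U /\ absconvex W.
Proof. by case: lcN => _ _ _ _ [_ + _ _]; apply. Qed.

Lemma lcHZ U a : a != 0 -> N U -> N (scale_set a U).
Proof. by case: lcN => _ _ _ _ [_ _ H _] a0 NU; exact: H. Qed.

Lemma lcH_half U : N U -> exists2 W, N W & forall u v, W u -> W v -> U (u + v).
Proof.
move=> /lcH_absconvex[W NW [WU cW]].
exists (scale_set 2^-1 W); first by apply: lcHZ => //; rewrite invr_eq0.
move=> _ _ [u Wu <-] [v Wv <-]; apply/WU/cW => //.
by rewrite ger0_norm ?invr_ge0 // -div1r -splitr.
Qed.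

Lemma lcH_functional_ball phi e : linear_functional phi ->
  continuous_functional N phi -> 0 < e -> N [set u | `|phi u| < e].
Proof.
move=> lphi cphi e0; have [U NU Ue] := cphi 0 e e0.
by apply: lcHS NU => u Uu /=; rewrite -[phi u]subr0 -(lf0 lphi) Ue // subr0.
Qed.

Lemma bounded_functional_continuous phi U c : linear_functional phi -> N U ->
  (forall u, U u -> `|phi u| <= c) -> continuous_functional N phi.
Proof.
move=> lphi NU Uc x e e0.
have c0 : 0 <= c by apply: le_trans (Uc 0 (lcH0 NU)).
have c1 : 0 < c + 1 by rewrite ltr_wpDl.
have a0 : 0 < e / (c + 1) by rewrite divr_gt0.
exists (scale_set (e / (c + 1)) U); first by apply: lcHZ => //; rewrite gt_eqF.
move=> y [u Uu yx]; rewrite -lfB // -yx lfZ // normrM gtr0_norm //.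
apply: le_lt_trans (_ : e / (c + 1) * c < _).
  by rewrite ler_wpM2l ?Uc // ltW.
by rewrite mulrAC -mulrA gtr_pMr // ltr_pdivrMr // mul1r ltrDl.
Qed.

Lemma bounded_in1 v : bounded_in N [set v].
Proof. by move=> U NU; exact: lcH_absorbing. Qed.

(** Members of [N] need not be open, whereas [compact_in] speaks of open covers; interiors of
    translates supply them. *)
Lemma open_in_interior A :
  open_in N [set x | exists2 U, N U & forall y, U (y - x) -> A y].
Proof.
move=> x [U NU UA]; have [W NW WU] := lcH_half NU.
exists W => // y Wy; exists W => // z Wz; apply: UA.
by rewrite -(subrK y z) -addrA; exact: WU.
Qed.

(** Without a limit, the open sets outside [G] would cover [A]. A finite subcover is impossible,
    since [G] contains [A] and the complements of its members. *)
Lemma compact_in_ultra A (G : set_system V) :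
  compact_in N A -> UltraFilter G -> G A ->
  exists2 a, A a & forall U, N U -> G [set u | U (u - a)].
Proof.
move=> coA UG GA; apply: contrapT => nlim.
have [|x Ax|D fD [DC AD]] := coA [set O | open_in N O /\ ~ G O].
- by move=> O [].
- have [U NU nGU] : exists2 U, N U & ~ G [set u | U (u - x)].
    apply: contrapT => H; apply: nlim; exists x => // U NU.
    by apply: contrapT => nG; apply: H; exists U.
  exists [set z | exists2 W, N W & forall y, W (y - z) -> U (y - x)].
    split; first exact: (@open_in_interior [set y | U (y - x)]).
    move=> GO; apply: nGU; apply: filterS GO => y [W NW]; apply.
    by rewrite subrr; exact: lcH0.
  by exists U.
- have /filter_ex[x [Ax nDx]] : G (A `&` \bigcap_(O in D) ~` O).
    apply: filterI => //; apply: filter_finite_bigcap => // O DO.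
    by case: (in_ultra_setVsetC O UG) => // GO; have [] := DC O DO.
  by have [Q DQ Qx] := AD x Ax; exact: nDx DQ Qx.
Qed.

(** Without a finite subcover, the sets left of [A] after removing finitely many members of [C]
    generate a proper filter. A limit of a finer ultrafilter lies in a member of [C] whose
    complement is in that ultrafilter. *)
Lemma ultra_compact_in A :
  (forall G : set_system V, UltraFilter G -> G A ->
    exists2 a, A a & forall U, N U -> G [set u | U (u - a)]) ->
  compact_in N A.
Proof.
move=> ultraA C openC AC; apply: contrapT => nsub.
pose cof D := A `&` \bigcap_(O in D) ~` O.
pose fin := [set D | finite_set D /\ D `<=` C].
have PF : ProperFilter (filter_from fin cof).
  apply: filter_from_proper; first apply: filter_from_filter.
  - by exists set0; split.
  - move=> D E [fD DC] [fE EC]; exists (D `|` E).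
      by split; [rewrite finite_setU | rewrite subUset].
    by move=> x [Ax DE]; split; split=> // O HO; apply: DE; [left|right].
  - move=> D [fD DC]; apply: contrapT => cof0; apply: nsub; exists D => //.
    split=> // x Ax; apply: contrapT => nDx; apply: cof0; exists x; split=> //.
    by move=> O DO Ox; apply: nDx; exists O.
have [G [UG FG]] := ultraFilterLemma PF.
have [|a Aa Ga] := ultraA G UG.
  by apply: FG; exists set0; [split; [exact: finite_set0|]|move=> x []].
have [ O CO Oa] := AC a Aa; have [U NU UO] := openC O CO a Oa.
have /filter_ex[x [Ux [_ /(_ O erefl)]]] :
    G ([set u | U (u - a)] `&` cof [set O]).
  apply: filterI; first exact: Ga.
  by apply: FG; exists [set O] => //; split; [exact: finite_set1|move=> _ ->].
by apply; exact: UO.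
Qed.

End Topology.

Section Absorption.
Variables (K : numFieldType) (V : lmodType K).
Implicit Types (A B U W : set V) (phi : V -> K).

(** With its converse [absorbs_polar], it trades absorption for uniform bounds, the form in which
    boundedness enters the duality arguments. *)
Lemma absorbs_polar_bounded U B : absorbs U B ->
  exists2 M : K, 0 < M & forall phi, linear_functional phi ->
    (forall u, U u -> `|phi u| <= 1) -> forall v, B v -> `|phi v| <= M.
Proof.
move=> /absorbsP[r r0 rB]; exists r^-1; rewrite ?invr_gt0 // => phi lphi U1 v Bv.
have rr : `|r| = r by rewrite gtr0_norm.
have := U1 _ (rB r _ _ v Bv); rewrite rr => /(_ r0 (lexx r)).
by rewrite lfZ // normrM rr -ler_pdivlMl // mulr1.
Qed.

Lemma absorbs_polar (X : Type) (b : X -> V -> K) (S : set X) B (M e : K) :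
  (forall x, linear_functional (b x)) -> 0 < M -> 0 < e ->
  (forall x v, S x -> B v -> `|b x v| <= M) -> absorbs (polar_in b S e) B.
Proof.
move=> lb M0 e0 bM; apply/absorbsP; exists (e / M); first by rewrite divr_gt0.
move=> a _ ae v Bv x Sx; rewrite lfZ // normrM.
apply: le_trans (_ : e / M * M <= _); last by rewrite divfK ?gt_eqF.
by apply: ler_pM => //; exact: bM.
Qed.

End Absorption.

Section PolarTopology.
Variables (K : numFieldType) (V : lmodType K) (X : Type) (b : X -> V -> K).
Variable GG : set (set X).

(** Uniform convergence on the members of [GG]: finite sets give the weak topology, [tau]-bounded
    sets give [beta]. All radii [e] occur because [GG] need not be stable under dilation. *)
Definition polar_top : set (set V) :=
  [set U | exists S e, [/\ GG S, 0 < e & polar_in b S e `<=` U]].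

Hypothesis lb : forall x, linear_functional (b x).
Hypothesis GG0 : GG !=set0.
Hypothesis GGU : forall S T, GG S -> GG T -> GG (S `|` T).
Hypothesis GGbounded : forall S v, GG S ->
  exists2 M : K, 0 < M & forall x, S x -> `|b x v| <= M.
Hypothesis GGsep : forall v, v != 0 -> exists S x, [/\ GG S, S x & b x v != 0].

Lemma polar_top_in S e : GG S -> 0 < e -> polar_top (polar_in b S e).
Proof. by move=> GS e0; exists S, e; split. Qed.

Lemma polar_top_lcH : lcH_top polar_top.
Proof.
split.
- by have [S GS] := GG0; exists S, 1.
- move=> U [S [e [GS e0]]]; apply=> x Sx.
  by rewrite lf0 // normr0 ltW.
- move=> U W [S [e [GS e0 SU]]] UW; exists S, e; split=> //.
  exact: subset_trans UW.
- move=> U W [S [e [GS e0 SU]]] [T [d [GT d0 TW]]].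
  have [c [c0 ce cd]] := pos_common_lb e0 d0.
  exists (S `|` T), c; split=> //; first exact: GGU.
  move=> v Hv; split; [apply: SU => x Sx|apply: TW => x Tx].
    by apply: le_trans (Hv x (or_introl Sx)) ce.
  by apply: le_trans (Hv x (or_intror Tx)) cd.
- split.
  + move=> U [S [e [GS e0 SU]]] v; have [M M0 bM] := GGbounded v GS.
    have [r r0 rS] := absorbs_polar lb M0 e0 (fun x w Sx (wv : [set v] w) =>
      eq_ind_r (fun w => `|b x w| <= M) (bM x Sx) wv).
    exists r => // l rl w /(rS l rl)[u Su <-]; exists u => //; exact: SU.
  + move=> U [S [e [GS e0 SU]]]; exists (polar_in b S e).
      exact: polar_top_in.
    by split=> //; exact: polar_absconvex.
  + move=> U a [S [e [GS e0 SU]]] a0; exists S, (`|a| * e); split=> //.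
      by rewrite mulr_gt0 // normr_gt0.
    move=> v Sv; apply/scale_setP => //; apply: SU => x Sx.
    by rewrite lfZ // normrM normfV ler_pdivrMl ?normr_gt0 //; exact: Sv.
  + move=> v /GGsep[S [x [GS Sx bxv]]].
    have b0 : 0 < `|b x v| / 2 by rewrite divr_gt0 // normr_gt0.
    exists (polar_in b S (`|b x v| / 2)); first exact: polar_top_in.
    move=> /(_ x Sx); rewrite ler_pdivlMr // mulr_natr mulr2n gerDl.
    by rewrite normr_le0 (negbTE bxv).
Qed.

Lemma polar_top_functional x S : lcH_top polar_top -> GG S -> S x ->
  continuous_functional polar_top (b x).
Proof.
move=> lcT GS Sx; apply: (bounded_functional_continuous lcT (lb x)
  (polar_top_in GS ltr01) (c := 1)) => u; exact.
Qed.

Lemma polar_top_bounded B :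
  (forall S, GG S -> exists2 M : K, 0 < M &
    forall x v, S x -> B v -> `|b x v| <= M) -> bounded_in polar_top B.
Proof.
move=> BB U [S [e [GS e0 SU]]]; have [M M0 bM] := BB S GS.
have [r r0 rS] := absorbs_polar lb M0 e0 bM.
by exists r => // l rl w /(rS l rl)[u Su <-]; exists u => //; exact: SU.
Qed.

End PolarTopology.

Section ClosedSeparation.
Variables (R : realType) (K : numFieldType) (j : {rmorphism R -> K}).
Hypothesis KS : scalar_field j.
Variables (V : lmodType K) (N : set (set V)).
Hypothesis lcN : lcH_top N.

Lemma closed_separation (W : set V) v0 : absconvex W -> W 0 -> closed_in N W ->
  ~ W v0 -> exists phi, [/\ linear_functional phi, continuous_functional N phi,
    forall w, W w -> `|phi w| <= 1 & 1 < `|phi v0|].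
Proof.
move=> cW W0 clW nWv; have [U NU UnW] := clW _ nWv.
have [U' NU' [U'U cU']] := lcH_absconvex lcN NU.
have [u /U'U U'u|phi [lphi phiW phiU phiv]] :=
  absconvex_separation KS cW cU' W0 (lcH_absorbing lcN NU') (v0 := v0).
  by apply: UnW; rewrite addrC addKr.
exists phi; split=> //.
exact: (bounded_functional_continuous lcN lphi NU' phiU).
Qed.

End ClosedSeparation.

Lemma finite_bounded (K : numFieldType) (X : eqType) (h : X -> K) (S : set X) :
  finite_set S -> exists2 M : K, 0 < M & forall x, S x -> `|h x| <= M.
Proof.
move=> /finite_seqP[s ->]; elim: s => [|y s [M M0 IH]]; first by exists 1.
exists (`|h y| + M); first by rewrite ltr_wpDl.
move=> x /=; rewrite inE => /predU1P[->|xs]; first by rewrite lerDl ltW.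
by apply: le_trans (IH x xs) _; rewrite lerDr.
Qed.

Section Norms.
Variable K : numFieldType.
Implicit Types (x y e : K).

Lemma normr_nle x y : 0 <= y -> ~ `|x| <= y -> y < `|x|.
Proof. by move=> y0 /negP; rewrite real_ltNge // ger0_real. Qed.

Lemma normr_small_eq0 x : (forall e, 0 < e -> `|x| <= e) -> x = 0.
Proof.
move=> H; apply/eqP; apply: contraT; rewrite -normr_gt0 => x0.
have := H (`|x| / 2) (divr_gt0 x0 (ltr0n _ 2)).
rewrite ler_pdivlMr // mulr_natr mulr2n gerDl => /(lt_le_trans x0).
by rewrite ltxx.
Qed.

Lemma normr_lt_near x y e : `|y - x| < `|x| - e -> e < `|y|.
Proof.
move=> H; rewrite -(ltrD2r `|y - x|).
apply: lt_le_trans (_ : `|x| <= _); first by rewrite -ltrBrDl.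
by rewrite [`|y - x|]distrC -{1}[x](subrK y) addrC ler_normD.
Qed.

End Norms.

Section PointwiseLimit.
Variables (K : numFieldType) (Y : lmodType K) (I : Type) (G : set_system I).
Context {PG : ProperFilter G}.
Variables (h : I -> Y -> K) (psi : Y -> K).
Hypothesis hpsi : forall y e, 0 < e -> G [set i | `|h i y - psi y| < e].

Lemma pointwise_limit_linear : (forall i, linear_functional (h i)) ->
  linear_functional psi.
Proof.
move=> lh a u v; apply/eqP; rewrite -subr_eq0; apply/eqP.
apply: normr_small_eq0 => e e0.
pose d := e / (`|a| + 2).
have a2 : 0 < `|a| + 2 by rewrite ltr_wpDl.
have d0 : 0 < d by rewrite divr_gt0.
have /filter_ex[i [[/= H1 H2] H3]] : G ([set i | `|h i (a *: u + v) -
    psi (a *: u + v)| < d] `&` [set i | `|h i u - psi u| < d] `&`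
    [set i | `|h i v - psi v| < d]).
  by apply: filterI; [apply: filterI|]; exact: hpsi.
have -> : psi (a *: u + v) - (a * psi u + psi v) =
    (psi (a *: u + v) - h i (a *: u + v)) +
    (a * (h i u - psi u) + (h i v - psi v)).
  by rewrite lh mulrBr; ring.
have -> : e = d + (`|a| * d + d).
  by rewrite /d; field; rewrite gt_eqF.
apply: le_trans (ler_normD _ _) _; apply: lerD; first by rewrite distrC ltW.
apply: le_trans (ler_normD _ _) _; apply: lerD; last exact: ltW.
by rewrite normrM ler_wpM2l // ltW.
Qed.

Lemma pointwise_limit_le y M : G [set i | `|h i y| <= M] -> `|psi y| <= M.
Proof.
move=> GM; have M0 : 0 <= M by have /filter_ex[i /= /(le_trans _)->] := GM.
apply: contrapT => /(normr_nle M0) Mpsi.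
have e0 : 0 < `|psi y| - M by rewrite subr_gt0.
have /filter_ex[i [/= H1 H2]] : G ([set i | `|h i y| <= M] `&`
    [set i | `|h i y - psi y| < `|psi y| - M]).
  by apply: filterI => //; exact: hpsi.
by have := lt_le_trans (normr_lt_near H2) H1; rewrite ltxx.
Qed.

End PointwiseLimit.

Lemma absorbsS (K : numFieldType) (V : lmodType K) (A A' B : set V) :
  A `<=` A' -> absorbs A B -> absorbs A' B.
Proof.
move=> AA' [r r0 H]; exists r => // l rl v /(H l rl)[u Au <-].
by exists u => //; exact: AA'.
Qed.

Lemma polar_closed (K : numFieldType) (V : lmodType K) (N : set (set V))
    (X : Type) (b : X -> V -> K) (S : set X) e : 0 <= e ->
  (forall x, S x -> continuous_functional N (b x)) ->
  closed_in N (polar_in b S e).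
Proof.
move=> e0 cb v nSv.
have [x Sx nx] : exists2 x, S x & ~ `|b x v| <= e.
  apply: contrapT => H; apply: nSv => x Sx; apply: contrapT => nx.
  by apply: H; exists x.
have {}nx := normr_nle e0 nx.
have [U NU Ux] := cb x Sx v (`|b x v| - e) (eq_ind_r is_true nx (subr_gt0 _ _)).
exists U => // y Uy /(_ x Sx) yS.
by have := lt_le_trans (normr_lt_near (Ux y Uy)) yS; rewrite ltxx.
Qed.

(** * Equicontinuity of the bounded sets *)

Section Implications.
Variables (R : realType) (K : numFieldType) (j : {rmorphism R -> K}).
Hypothesis KS : scalar_field j.
Variables (Omega : topologicalType) (V : lmodType K) (ev : V -> Omega -> K).
Hypothesis evl : forall (a : K) f g x, ev (a *: f + g) x = a * ev f x + ev g x.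
Variable N : set (set V).

Lemma linearisation_equicontinuous :
  has_cont_strong_cb_linearisation ev N ->
  exists Nt, [/\ lcH_top Nt, finer_than_pointwise ev Nt,
    BBC N Nt, CNC N Nt & forall B, bounded_in N B -> equicontinuous_set ev B].
Proof.
move=> [Y [NY [delta [T [lcNY Tdual Tlin Tinj
  [Tsurj Tdelta Tstrong [_ barY] cdelta]]]]]].
have lT f : linear_functional (T f) by case: (Tdual f).
pose b y f := T f y.
have lb y : linear_functional (b y) by move=> a f g; rewrite /b Tlin.
have NP S : bounded_in NY S -> N (polar_in b S 1).
  by move=> bS; apply/Tstrong; exists S.
pose Nt := polar_top b (@finite_set Y).
have lcNt : lcH_top Nt.
  apply: polar_top_lcH => //.
  - by exists set0; exact: finite_set0.
  - by move=> S S' fS fS'; rewrite finite_setU.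
  - by move=> S f; exact: finite_bounded.
  - move=> f f0; have [y fy] : exists y, T f y != 0.
      apply: contrapT => H; move/eqP: f0; apply; apply: Tinj.
      apply/funext => y; rewrite -[T 0 y]/(b y 0) (lf0 (lb y)).
      by apply/eqP; apply: contrapT => /negP fy; apply: H; exists y.
    by exists [set y], y; split=> //; exact: finite_set1.
(* This polar is absorbing because the polar of a single point of [Y] is a [tau]-neighbourhood and
   hence absorbs [B]. *)
have barrel B : bounded_in N B -> NY (polar_in T B 1).
  move=> bB; apply: barY; first exact: polar_absconvex.
  - move=> y; have := bB _ (NP _ (bounded_in1 lcNY y)).
    move=> /absorbs_polar_bounded[M M0 BM].
    apply: (absorbs_polar lT M0 ltr01) => f z Bf ->.
    by apply: (BM (b y)) => // g; apply.
  - by apply: polar_closed => // f _; case: (Tdual f).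
exists Nt; split=> //.
- move=> x e e0; have e2 : 0 < e / 2 by rewrite divr_gt0.
  exists [set delta x], (e / 2); split=> //.
  move=> f /(_ (delta x) erefl); rewrite /b Tdelta => H /=.
  by apply: le_lt_trans H _; rewrite ltr_pdivrMr // mulr_natr mulr2n ltrDl.
- move=> B bB; have ND := barrel _ bB; set D := polar_in T B 1 in ND.
  (* The disc is the bipolar of [B]. It is [tau]-bounded since the neighbourhood [D] absorbs bounded
     sets of [Y]; it is weakly compact since a pointwise limit of functionals bounded by 1 on [D] is
     again continuous, hence some [T f0]. *)
  exists (polar_in b D 1); split.
  + by move=> f Bf y; apply.
  + exact: polar_absconvex.
  + move=> U /Tstrong[S bS SU]; apply: (@absorbsS _ _ (polar_in b S 1)).
      by apply: subset_trans SU => f.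
    have [M M0 SM] := absorbs_polar_bounded (bS _ ND).
    by apply: (absorbs_polar lb M0 ltr01) => y f Sy fD; exact: SM.
  + apply: ultra_compact_in => G UG GD.
    have /choice[psi hpsi] : forall y, exists l,
        forall e, 0 < e -> G [set f | `|b y f - l| < e].
      move=> y.
      have [M _ yM] := absorbs_polar_bounded (lcH_absorbing lcNY ND y).
      apply: (@scal_ultra _ _ _ KS _ _ _ M).
      by apply: filterS GD => f fD /=; exact: yM.
    have lpsi : linear_functional psi.
      exact: (@pointwise_limit_linear _ _ _ G _ (fun f => T f) _ hpsi).
    have psi1 y : D y -> `|psi y| <= 1.
      move=> Dy; apply: (@pointwise_limit_le _ _ _ G _ (fun f => T f) _ hpsi).
      by apply: filterS GD => f; exact.
    have [f0 f0psi] := Tsurj psi lpsi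
      (bounded_functional_continuous lcNY lpsi ND psi1).
    exists f0; first by move=> y Dy; rewrite /b f0psi; exact: psi1.
    move=> U [S [e [fS e0 SU]]].
    have : G (\bigcap_(y in S) [set f | `|b y f - psi y| < e]).
      by apply: filter_finite_bigcap => // y _; exact: hpsi.
    apply: filterS => f Hf; apply: SU => y Sy.
    by rewrite lfB // {2}/b f0psi ltW //; exact: Hf.
- move=> U NU; have /Tstrong[S bS SU] := NU.
  exists (polar_in b S 1); split=> //; first exact: NP.
    exact: polar_absconvex.
  apply: polar_closed => // y _.
  exact: (polar_top_functional lb lcNt (finite_set1 y)).
- move=> B /barrel ND x e e0.
  have e2 : 0 < e / 2 by rewrite divr_gt0.
  have := cdelta x _ (lcHZ lcNY (lt0r_neq0 e2) ND).
  apply: filterS => z [y Dy yz] f Bf.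
  rewrite -!Tdelta -lfB // -yz lfZ // normrM gtr0_norm //.
  apply: le_lt_trans (_ : e / 2 * 1 < _); first by rewrite ler_wpM2l ?Dy // ltW.
  by rewrite mulr1 ltr_pdivrMr // mulr_natr mulr2n ltrDl.
Qed.

(** Uniform convergence of [delta_z] to [delta_x] on [B] is equicontinuity of [B] at [x], and
    [delta_x] is continuous for any topology finer than the pointwise one. *)
Lemma equicontinuous_Delta Nt : finer_than_pointwise ev Nt ->
  (forall B, bounded_in N B -> equicontinuous_set ev B) ->
  (forall x, in_FBdual N Nt (fun f => ev f x)) /\ Delta_beta_continuous ev N.
Proof.
move=> fine eqc; split=> [x|x B bB e e0].
  split=> [a f g|B bB f Bf e e0]; first exact: evl.
  exists [set g | `|ev g x| < e]; first exact: fine.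
  by move=> g Bg /=; rewrite (@lfB _ _ (fun f => ev f x)).
by apply: filterS (eqc B bB x e e0) => z H f Bf; rewrite ltW //; exact: H.
Qed.

Hypothesis evc : forall f, Kcontinuous (ev f).

(** The easy half of Ascoli's theorem: functions uniformly close to [f] on [C] inherit its modulus
    at [x] up to thirds of [e], and finitely many such neighbourhoods cover [A]. *)
Lemma compact_in_equicontinuous_on Nt A (C : set Omega) x (e : K) :
  lcH_top Nt -> finer_than_compact_open ev Nt -> compact_in Nt A ->
  compact C -> C x -> 0 < e ->
  \forall z \near x, C z -> forall f, A f -> `|ev f z - ev f x| < e.
Proof.
move=> lcNt fine coA coC Cx e0.
have lev z : linear_functional (ev^~ z) by move=> a u v; exact: evl.
have e3 : 0 < e / 3 by rewrite divr_gt0.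
pose small O := \forall z \near x, C z -> forall f, O f -> `|ev f z - ev f x| < e.
have [|f Af|D fD [DC AD]] := coA [set O | open_in Nt O /\ small O].
- by move=> O [].
- pose U := [set g | forall z, C z -> `|ev g z| < e / 3].
  exists [set g | exists2 W, Nt W & forall h, W (h - g) -> U (h - f)]; last first.
    by exists U => //; exact: fine.
  split; first exact: (open_in_interior lcNt (A := [set h | U (h - f)])).
  apply: filterS (evc f x e3) => z fz Cz g [W NW gf].
  have {}gf : U (g - f) by apply: gf; rewrite subrr; exact: (lcH0 lcNt).
  have -> : ev g z - ev g x =
      ev (g - f) z + ((ev f z - ev f x) - ev (g - f) x).
    by rewrite !(lfB (lev _)); ring.
  have -> : e = e / 3 + (e / 3 + e / 3) by field.
  apply: le_lt_trans (ler_normD _ _) _; rewrite ltrD ?gf //.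
  by apply: le_lt_trans (ler_normB _ _) _; rewrite ltrD ?gf.
- have : \forall z \near x, forall O, D O -> C z ->
      forall f, O f -> `|ev f z - ev f x| < e.
    by apply: filter_finite_bigcap => // O /DC[].
  apply: filterS => z H Cz f /AD[Q DQ Qf]; exact: H Qf.
Qed.

(** Equicontinuity at [x] is encoded in one real function [h], to which the [gkR_space] property
    applies. Truncation at 1 keeps the supremum finite without a pointwise bound on [B]. *)
Lemma gkR_equicontinuous Nt : gkR_space Omega -> lcH_top Nt ->
  finer_than_compact_open ev Nt -> BBC N Nt ->
  forall B, bounded_in N B -> equicontinuous_set ev B.
Proof.
move=> gk lcNt fine bbc B bB x e e0.
have [[f0 Bf0]|B0] := pselect (B !=set0); last first.
  by apply: nearW => z f Bf; case: B0; exists f.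
have /choice[nm nmE] : forall z : K, exists r, `|z| = j r.
  by move=> z; exact: (scal_nneg KS).
have nm0 z : 0 <= nm z by rewrite -(scal_le KS) rmorph0 -nmE.
pose dist f z := Num.min 1 (nm (ev f z - ev f x)).
pose h z := sup [set dist f z | f in B].
have hub z : ubound [set dist f z | f in B] 1.
  by move=> _ [f _ <-]; rewrite ge_min lexx.
have dh f z : B f -> dist f z <= h z.
  by move=> Bf; apply: ub_le_sup; [exists 1; exact: hub | exists f].
(* [h] varies no more than the members of [B] do, so their common modulus on [C] becomes a modulus
   of [h]. *)
have hle z w d : (forall f, B f -> nm (ev f z - ev f w) <= d) -> h z <= h w + d.
  move=> H; apply: ge_sup; first by exists (dist f0 z), f0.
  move=> _ [f Bf <-]; apply: le_trans (_ : dist f w + d <= _); last first.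
    by rewrite lerD2r; exact: dh.
  have zw : nm (ev f z - ev f x) <= nm (ev f w - ev f x) + d.
    apply: le_trans (_ : nm (ev f w - ev f x) + nm (ev f z - ev f w) <= _);
      last by rewrite lerD2l; exact: H.
    rewrite -(scal_le KS) rmorphD -!nmE.
    by rewrite -[X in `|X - ev f x|](subrK (ev f w)) -addrA addrC ler_normD.
  have d0 : 0 <= d by exact: le_trans (H f Bf).
  rewrite /dist; case: (leP 1 (nm (ev f w - ev f x))) => _.
    by rewrite ge_min lerDl d0.
  by rewrite ge_min zw orbT.
have ch : continuous h.
  apply: gk; first exact: (@uniform_completely_regular R).
  move=> C coC; apply/subspace_continuousP => y Cy; apply/cvgrPdist_le => d d0.
  have [A [BA _ _ coA]] := bbc B bB.
  have jd : 0 < j d.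
    by rewrite lt_neqAle eq_sym fmorph_eq0 gt_eqF //= -(rmorph0 j) (scal_le KS) ltW.
  have := compact_in_equicontinuous_on lcNt fine coA coC Cy jd.
  apply: filterS => z H Cz.
  have {}H f : B f -> nm (ev f z - ev f y) <= d.
    by move=> /BA Af; rewrite -(scal_le KS) -nmE ltW // H.
  rewrite ler_distl; apply/andP; split.
    rewrite lerBlDr; apply: hle => f Bf; exact: H.
  apply: hle => f Bf.
  suff -> : nm (ev f y - ev f z) = nm (ev f z - ev f y) by exact: H.
  by apply: (fmorph_inj j); rewrite -!nmE distrC.
have hx : h x = 0.
  apply/eqP; rewrite eq_le; apply/andP; split.
    apply: ge_sup; first by exists (dist f0 x), f0.
    move=> _ [f Bf <-]; rewrite /dist subrr (_ : nm 0 = 0) ?ge_min ?lexx ?orbT //.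
    by apply: (fmorph_inj j); rewrite -nmE rmorph0 normr0.
  by apply: le_trans (dh f0 x Bf0); rewrite le_min ler01 nm0.
have [e' ee] := scal_nneg KS (ltW e0).
have e'0 : 0 < e'.
  by rewrite lt_neqAle -(scal_le KS) rmorph0 -ee (ltW e0) andbT eq_sym
    -(fmorph_eq0 j) -ee gt_eqF.
(* Below 1 the truncation is inactive, so [h z < min 1 e'] bounds the actual differences. *)
have c0 : 0 < Num.min 1 e' by rewrite lt_min ltr01.
have /cvgrPdist_lt/(_ _ c0) := ch x.
rewrite hx; apply: filterS => z; rewrite sub0r normrN => hz f Bf.
have := le_lt_trans (le_trans (dh f z Bf) (ler_norm _)) hz.
rewrite /dist !lt_min !gt_min ltxx /= => /andP[H1 /orP[|H2]].
  by move=> e1; rewrite nmE ee lt_neqAle (scal_le KS) (inj_eq (fmorph_inj j))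
    ?(lt_eqF (lt_trans H1 e1)) ?(ltW (lt_trans H1 e1)).
by rewrite nmE ee lt_neqAle (scal_le KS) (inj_eq (fmorph_inj j)) (lt_eqF H2) ltW.
Qed.

End Implications.

(** * Barrels and Banach discs *)

Section GlidingHump.
Variables (R : realType) (K : numFieldType) (j : {rmorphism R -> K}).
Hypothesis KS : scalar_field j.

Lemma scalar_archi (M : K) : 0 <= M -> exists n : nat, M < n%:R.
Proof.
move=> M0; have [r rM] := scal_nneg KS M0; exists (Num.truncn r).+1.
rewrite rM -(rmorph_nat j) lt_neqAle (scal_le KS) (inj_eq (fmorph_inj j)).
have r0 : 0 <= r by rewrite -(scal_le KS) rmorph0 -rM.
by have := truncnS_gt r => H; rewrite (ltW H) lt_eqF.
Qed.

Lemma scalar_expV_small (M e : K) : 0 < M -> 0 < e ->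
  exists n : nat, 3^-1 ^+ n * M <= e.
Proof.
move=> M0 e0; have [n Mn] := scalar_archi (ltW (divr_gt0 M0 e0)).
exists n; rewrite exprVn ler_pdivrMl ?exprn_gt0 // -ler_pdivrMr //.
by apply: le_trans (ltW Mn) _; rewrite -natrX ler_nat ltnW // ltn_expl.
Qed.

Variables (X : Type) (Y : lmodType K) (b : X -> Y -> K) (S : set X) (E : set Y).
Hypothesis lb : forall x, linear_functional (b x).
Hypothesis cE : absconvex E.
Hypothesis Ebounded : forall x, S x ->
  exists2 M, 0 < M & forall y, E y -> `|b x y| <= M.
Hypothesis Sbounded : forall y, exists2 M, 0 < M & forall x, S x -> `|b x y| <= M.
(** The radius [3^-n / 2] is the sum of all steps [3^-(n+1) + 3^-(n+2) + ...] after stage [n]. *)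
Hypothesis Ecomplete : forall u : nat -> Y,
  (forall n, scale_set (3^-1 ^+ n.+1) E (u n.+1 - u n)) ->
  exists v, forall n, scale_set (3^-1 ^+ n / 2) E (v - u n).

(** The factor 3/2 comes from choosing [e] within a third of the supremum. Any factor below 2 would
    leave something of the hump after a move of half a step. *)
Lemma functional_almost_max x c : S x -> 0 < c ->
  (exists2 y, E y & 3 / 2 * c < `|b x y|) ->
  exists e, [/\ E e, c < `|b x e| &
    forall y, E y -> `|b x y| <= 3 / 2 * `|b x e|].
Proof.
move=> Sx c0 [y0 Ey0 cy0].
have /choice[nm nmE] : forall z : K, exists r, `|z| = j r.
  by move=> z; exact: (scal_nneg KS).
have [M M0 EM] := Ebounded Sx.
have [m mM] := scal_nneg KS (ltW M0).
pose s := sup [set nm (b x y) | y in E].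
have hs : has_sup [set nm (b x y) | y in E].
  split; first by exists (nm (b x y0)), y0.
  by exists m => _ [y Ey <-]; rewrite -(scal_le KS) -nmE -mM EM.
have les y : E y -> nm (b x y) <= s.
  by move=> Ey; apply: ub_le_sup; [exact: hs.2 | exists y].
have y0p : 0 < nm (b x y0).
  rewrite lt_neqAle -(scal_le KS) rmorph0 -nmE normr_ge0 andbT eq_sym.
  rewrite -(fmorph_eq0 j) -nmE gt_eqF //.
  by apply: lt_trans cy0; rewrite mulr_gt0 // divr_gt0.
have s0 : 0 < s by apply: lt_le_trans y0p (les _ Ey0).
have s3 : 0 < s / 3 by rewrite divr_gt0.
have [_ [e Ee <-]] := sup_adherent s3 hs; rewrite -/s => se.
have {}se y : E y -> `|b x y| <= 3 / 2 * `|b x e|.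
  have -> : 3 / 2 = j (3 / 2) by rewrite fmorph_div !rmorph_nat.
  move=> Ey; rewrite !nmE -rmorphM (scal_le KS).
  by apply: le_trans (les y Ey) _; lra.
exists e; split=> //.
have h32 : 0 < 3 / 2 :> K by rewrite divr_gt0.
by rewrite -(ltr_pM2l h32); apply: lt_le_trans cy0 (se _ Ey0).
Qed.

(* Of the two points [u + t e] and [u - t e], one has an image at least as long
   as half the difference [2 t b(e)] of the two images. *)
Lemma hump_step x e u (t : K) : 0 <= t -> E e ->
  exists2 v, scale_set t E (v - u) & t * `|b x e| <= `|b x v|.
Proof.
move=> t0 Ee.
have [H|/negP H] := pselect (t * `|b x e| <= `|b x (u + t *: e)|).
  by exists (u + t *: e) => //; exists e; rewrite // addrC addKr.
exists (u + t *: (- e)).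
  exists (- e); last by rewrite addrC addKr.
  by rewrite -scaleN1r; apply: absconvexZ; rewrite // normrN normr1.
have te_real : t * `|b x e| \is Num.real by rewrite ger0_real // mulr_ge0.
apply: contraT => H'; move: H H'; rewrite -!real_ltNge // => H H'.
have E2 : b x (u + t *: e) - b x (u + t *: - e) = (t * b x e) *+ 2.
  by rewrite scalerN lfD // lfB // lfZ //; ring.
have := ler_normB (b x (u + t *: e)) (b x (u + t *: - e)).
rewrite E2 normrMn normrM ger0_norm // mulr2n => /le_lt_trans/(_ (ltrD H H')).
by rewrite ltxx.
Qed.

Lemma gliding_hump : exists2 M, 0 < M &
  forall x y, S x -> E y -> `|b x y| <= M.
Proof.
apply: contrapT => nM.
have unb M : 0 < M -> exists x y, [/\ S x, E y & M < `|b x y|].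
  move=> M0; apply: contrapT => H; apply: nM; exists M => // x y Sx Ey.
  apply: contrapT => /(normr_nle (ltW M0)) My; apply: H; by exists x, y.
have p3 n : 0 < 3^-1 ^+ n :> K by rewrite exprn_gt0.
(* From stage [p.1] and point [p.2], a functional and a next point are chosen whose lower bound
   persists under any further move by half of the step, hence at the limit. *)
have /choice[next nextP] : forall p : nat * Y, exists q : X * Y,
    [/\ S q.1, scale_set (3^-1 ^+ p.1.+1) E (q.2 - p.2) &
    forall v, scale_set (3^-1 ^+ p.1.+1 / 2) E (v - q.2) -> p.1%:R <= `|b q.1 v|].
  move=> [n u] /=; set t := 3^-1 ^+ n.+1.
  have t0 : 0 < t by exact: p3.
  (* A quarter of [t * |b x e|] survives, which explains the 4; [n.+1] in place of [n] keeps the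
     threshold positive at [n = 0]. *)
  have c0 : 0 < 4 * n.+1%:R / t by rewrite divr_gt0 // mulr_gt0.
  have [|x [y [Sx Ey xy]]] := unb (3 / 2 * (4 * n.+1%:R / t)).
    by rewrite mulr_gt0 // divr_gt0.
  have [|e [Ee ce emax]] := functional_almost_max Sx c0; first by exists y.
  have [v vu ev] := hump_step x u (ltW t0) Ee.
  exists (x, v); split=> // w [e' Ee' wv] /=.
  have {}wv : w = v + (t / 2) *: e' by rewrite wv addrC subrK.
  have le_v : `|b x v| <= `|b x w| + t / 2 * (3 / 2 * `|b x e|).
    have -> : b x v = b x w - t / 2 * b x e' by rewrite wv lfD // lfZ // addrK.
    apply: le_trans (ler_normB _ _) _; rewrite lerD2l normrM.
    rewrite gtr0_norm ?divr_gt0 // ler_wpM2l ?emax //.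
    by rewrite ltW // divr_gt0.
  have := le_trans ev le_v; rewrite -lerBlDr.
  have -> : t * `|b x e| - t / 2 * (3 / 2 * `|b x e|) = 4^-1 * (t * `|b x e|).
    by field.
  apply: le_trans; rewrite ler_pdivlMl // -ler_pdivrMl //.
  apply: le_trans (ltW ce); rewrite [t^-1 * _]mulrC.
  by rewrite ler_wpM2r ?invr_ge0 ?(ltW t0) // ler_wpM2l // ler_nat.
pose u := fix u n := if n is m.+1 then (next (m, u m)).2 else 0.
have [|v vu] := @Ecomplete u.
  by move=> n; have [_ + _] := nextP (n, u n).
have [M M0 SM] := Sbounded v.
have [n Mn] := scalar_archi (ltW M0).
have [Sx _ /(_ v (vu n.+1)) nv] := nextP (n, u n).
by have := lt_le_trans Mn (le_trans nv (SM _ Sx)); rewrite ltxx.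
Qed.

End GlidingHump.

(** * The predual *)

Section DualSpace.
Variables (K : numFieldType) (V : lmodType K) (N Nt : set (set V)).

(** The proof that [Nt] is a locally convex topology is a parameter, so that the module structure
    can be inferred from the predicate: closure under sums intersects neighbourhoods. The codomain
    [K^o] makes the functionals a module. *)
Definition FBpred (_ : lcH_top Nt) : {pred V -> K^o} :=
  fun phi => `[< in_FBdual N Nt phi >].

Hypothesis lcNt : lcH_top Nt.

Lemma FBpred_submod : submod_closed (FBpred lcNt).
Proof.
split=> [|a phi psi /asboolP[lphi cphi] /asboolP[lpsi cpsi]]; apply/asboolP.
  split=> [a u v|B bB f Bf e e0]; first by rewrite /= mulr0 addr0.
  by exists setT; [exact: lcHT|move=> g _ _; rewrite subrr normr0].
split=> [c u v|B bB f Bf e e0].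
  by rewrite -![(_ + _) _]/(_ + _) -![(a *: _) _]/(a * _) lphi lpsi; ring.
have a1 : 0 < `|a| + 1 by rewrite ltr_wpDl.
have d0 : 0 < e / (`|a| + 1) by rewrite divr_gt0.
have [U NU Uphi] := cphi B bB f Bf _ d0.
have [W NW Wpsi] := cpsi B bB f Bf _ d0.
exists (U `&` W) => [|g Bg [Ug Wg]]; first exact: lcHI.
have -> : (a *: phi + psi) g - (a *: phi + psi) f =
    a * (phi g - phi f) + (psi g - psi f).
  by rewrite -![(_ + _) _]/(_ + _) -![(a *: _) _]/(a * _); ring.
have -> : e = `|a| * (e / (`|a| + 1)) + e / (`|a| + 1).
  by field; rewrite gt_eqF.
apply: le_lt_trans (ler_normD _ _) _; apply: ler_ltD; last exact: Wpsi.
by rewrite normrM ler_wpM2l // ltW // Uphi.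
Qed.

HB.instance Definition _ :=
  GRing.isSubmodClosed.Build K (V -> K^o) (FBpred lcNt) FBpred_submod.

Record FB (h : lcH_top Nt) := MkFB { FBval : V -> K^o; _ : FBval \in FBpred h }.
HB.instance Definition _ := [isSub for @FBval lcNt].
HB.instance Definition _ := [Choice of FB lcNt by <:].
HB.instance Definition _ := [SubChoice_isSubLmodule of FB lcNt by <:].

Definition pairing (f : V) (y : FB lcNt) : K := FBval y f.

Lemma FB_in_FBdual (y : FB lcNt) : in_FBdual N Nt (pairing^~ y).
Proof. by case: y => phi phiP; apply/asboolP. Qed.

Lemma FB_mk phi : in_FBdual N Nt phi -> exists y, pairing^~ y = phi.
Proof. by move=> /asboolP phiP; exists (MkFB phiP). Qed.

Lemma pairing_linear f : linear_functional (pairing f).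
Proof. by []. Qed.

Lemma pairing_linearl y : linear_functional (pairing^~ y).
Proof. by case: (FB_in_FBdual y). Qed.

Lemma pairing_inj (y z : FB lcNt) : pairing^~ y = pairing^~ z -> y = z.
Proof. by move=> yz; apply: val_inj. Qed.

End DualSpace.

Section BoundedSets.
Variables (K : numFieldType) (V : lmodType K).

Lemma lf_sum (n : nat) (phi : V -> K) (a : 'I_n -> K) (u : 'I_n -> V) :
  linear_functional phi -> phi (\sum_i a i *: u i) = \sum_i a i * phi (u i).
Proof.
move=> lphi; rewrite (big_morph phi (lfD lphi) (lf0 lphi)).
by apply: eq_bigr => i _; rewrite lfZ.
Qed.

Lemma absorbsU (A S T : set V) :
  absorbs A S -> absorbs A T -> absorbs A (S `|` T).
Proof.
move=> /absorbsP[r r0 Sr] /absorbsP[s s0 Ts]; apply/absorbsP.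
have [c [c0 cr cs]] := pos_common_lb r0 s0; exists c => // a a0 ac u [Su|Tu].
  by apply: Sr => //; exact: le_trans cr.
by apply: Ts => //; exact: le_trans cs.
Qed.

Lemma absorbs_scale (A S : set V) a : a != 0 -> absorbs A S ->
  absorbs A (scale_set a S).
Proof.
move=> a0 /absorbsP[r r0 Sr]; apply/absorbsP.
have na0 : 0 < `|a| by rewrite normr_gt0.
exists (r / `|a|); first by rewrite divr_gt0.
move=> c c0 cr _ [u Su <-]; rewrite scalerA; apply: Sr => //.
  by rewrite normrM mulr_gt0.
by rewrite normrM -ler_pdivlMr.
Qed.

Lemma bounded_inU (N : set (set V)) S T :
  bounded_in N S -> bounded_in N T -> bounded_in N (S `|` T).
Proof. by move=> bS bT U NU; apply: absorbsU; [exact: bS|exact: bT]. Qed.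

End BoundedSets.

(** * Duality between F and its predual *)

Section StrongDual.
Variables (R : realType) (K : numFieldType) (j : {rmorphism R -> K}).
Hypothesis KS : scalar_field j.
Variables (V : lmodType K) (N Nt : set (set V)).
Hypothesis lcN : lcH_top N.
Hypothesis lcNt : lcH_top Nt.
Hypothesis bbc : BBC N Nt.
Hypothesis cnc : CNC N Nt.

Local Notation Y := (FB N lcNt).
Local Notation pair := (@pairing K V N Nt lcNt).
Local Notation beta := (polar_top pair (bounded_in N)).

Let lp f : linear_functional (pair f) := @pairing_linear K V N Nt lcNt f.
Let lpl y : linear_functional (pair^~ y) := @pairing_linearl K V N Nt lcNt y.

(** Elements of the predual are [Nt]-continuous on the bounded set [A], so an [Nt]-limit in [A] is
    also a limit for the pairing. *)
Lemma bounded_compact_limit A (G : set_system V) :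
  bounded_in N A -> compact_in Nt A -> UltraFilter G -> G A ->
  exists2 a, A a & forall y e, 0 < e -> G [set f | `|pair f y - pair a y| < e].
Proof.
move=> bA coA UG GA; have [a Aa Ga] := compact_in_ultra lcNt coA UG GA.
exists a => // y e e0; have [U NU Uy] := (FB_in_FBdual y).2 A bA a Aa e e0.
have : G (A `&` [set f | U (f - a)]) by apply: filterI => //; exact: Ga.
by apply: filterS => f [Af Uf]; exact: Uy.
Qed.

(** Continuity on bounded sets does not by itself give boundedness on them; (BBC) does, by enclosing
    them in compact ones. This is what makes [beta]-neighbourhoods absorbing. *)
Lemma pairing_bounded B y : bounded_in N B ->
  exists2 M : K, 0 < M & forall f, B f -> `|pair f y| <= M.
Proof.
move=> bB; have [A [BA _ bA coA]] := bbc bB.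
suff [M M0 AM] : exists2 M : K, 0 < M & forall f, A f -> `|pair f y| <= M.
  by exists M => // f /BA; exact: AM.
apply: contrapT => nM.
pose S M := A `&` [set f | M < `|pair f y|].
have PF : ProperFilter (filter_from [set M : K | 0 < M] S).
  apply: filter_from_proper; first apply: filter_from_filter.
  - by exists 1 => /=.
  - move=> M M' /= M0 M'0.
    have /orP[MM|MM] := real_leVge (gtr0_real M0) (gtr0_real M'0).
      exists M' => // f [Af /= Mf]; split; split=> //=; exact: le_lt_trans Mf.
    exists M => // f [Af /= Mf]; split; split=> //=; exact: le_lt_trans Mf.
  - move=> M /= M0; apply: contrapT => S0; apply: nM; exists M => // f Af.
    apply: contrapT => /(normr_nle (ltW M0)) Mf; apply: S0; by exists f.
have [G [UG FG]] := ultraFilterLemma PF.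
have [|a Aa /(_ y 1 ltr01) Ga] := bounded_compact_limit bA coA UG.
  by apply: FG; exists 1 => //= f [].
have M0 : 0 < `|pair a y| + 1 by rewrite ltr_wpDl.
have /filter_ex[f [[_ /= Mf] /= fa]] : G (S (`|pair a y| + 1) `&`
    [set f | `|pair f y - pair a y| < 1]).
  by apply: filterI => //; apply: FG; exists (`|pair a y| + 1).
have : `|pair a y| < `|pair a y|.
  apply: (@normr_lt_near _ (pair f y)).
  by rewrite distrC (lt_le_trans fa) // lerBrDl ltW.
by rewrite ltxx.
Qed.

Lemma beta_lcH : lcH_top beta.
Proof.
apply: polar_top_lcH => //.
- by exists [set 0]; exact: bounded_in1.
- by move=> S T; exact: bounded_inU.
- by move=> S y; exact: pairing_bounded.
- move=> y y0; have [f fy] : exists f, pair f y != 0.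
    apply: contrapT => H; move/eqP: y0; apply; apply: pairing_inj.
    apply/funext => f; rewrite (lf0 (lp f)).
    by apply/eqP; apply: contrapT => /negP fy; apply: H; exists f.
  by exists [set f], f; split=> //; exact: bounded_in1.
Qed.

Lemma beta_unit U : beta U ->
  exists2 S, bounded_in N S & polar_in pair S 1 `<=` U.
Proof.
move=> [S [e [bS e0 SU]]]; exists (scale_set e^-1 S).
  by move=> W NW; apply: absorbs_scale; [rewrite invr_eq0 gt_eqF|exact: bS].
move=> y Sy; apply: SU => f Sf.
have := Sy (e^-1 *: f); rewrite (lfZ (lpl y)) normrM normfV (gtr0_norm e0).
by rewrite ler_pdivrMl // mulr1; apply; exists f.
Qed.

Lemma pairing_continuous f : continuous_functional beta (pair f).
Proof.
exact: (polar_top_functional lp beta_lcH (bounded_in1 lcN f)).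
Qed.

(* Separation in K^n: the values of [n] functionals on [A] come arbitrarily close
   to those of [psi], as otherwise some combination of them is at most 1 on [A]
   but sent by [psi] outside the unit disc. *)
Lemma finite_approximation (psi : Y -> K) A : linear_functional psi ->
  absconvex A -> A 0 ->
  (forall y, (forall f, A f -> `|pair f y| <= 1) -> `|psi y| <= 1) ->
  forall (S : set Y) (d : K), finite_set S -> 0 < d ->
  exists2 f, A f & forall y, S y -> `|pair f y - psi y| <= d.
Proof.
move=> lpsi cA A0 psi1 S d /finite_seqP[s ->] d0.
apply: contrapT => nf; pose n := size s.
pose y (i : 'I_n) : Y := tnth (in_tuple s) i.
pose E : lmodType K := 'I_n -> K^o.
pose P f : E := fun i => pair f (y i).
pose x0 : E := fun i => psi (y i).
have lE (i : 'I_n) : linear_functional (fun x : E => x i : K) by [].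
have cW : absconvex (P @` A).
  move=> a b ab _ _ [f Af <-] [g Ag <-].
  exists (a *: f + b *: g); first exact: cA.
  by apply/funext => i; rewrite /P lpl (lfZ (lpl (y i))).
have W0 : (P @` A) 0.
  by exists 0 => //; apply/funext => i; rewrite /P (lf0 (lpl (y i))).
have aU : absorbing (polar_in (fun (i : 'I_n) (x : E) => x i : K) setT d).
  move=> x.
  have [M M0 xM] := finite_bounded (x : 'I_n -> K) (@finite_finset _ setT).
  by apply: (absorbs_polar lE M0 d0) => i _ _ ->; exact: xM.
have [u uU [f Af fE]|Phi [lPhi PhiW _ Phi0]] := absconvex_separation KS cW
    (polar_absconvex lE) W0 aU (v0 := x0).
  apply: nf; exists f => // z /= /(nthP 0)[i si <-].
  have := uU (Ordinal si) I; congr (`|_| <= _).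
  have := congr1 (fun x : E => x (Ordinal si)) fE.
  rewrite /P /x0 /y (tnth_nth 0) /= => ->.
  by rewrite -[(_ + u) _]/(psi _ + u _) (tnth_nth 0) /= addrC addKr.
pose e (i : 'I_n) : E := fun k => (k == i)%:R.
have EE (x : E) : x = \sum_i (x i : K) *: e i.
  apply/funext => k; rewrite fct_sumE (bigD1 k) //= big1 => [|i ik].
    by rewrite addr0 -[(_ *: _) k]/(x k * (k == k)%:R) eqxx mulr1.
  by rewrite -[(_ *: _) k]/(x i * (k == i)%:R) eq_sym (negbTE ik) mulr0.
have PhiE (x : E) : Phi x = \sum_i (x i : K) * Phi (e i).
  by rewrite [in LHS](EE x) lf_sum.
pose z : Y := \sum_i Phi (e i) *: y i.
have : `|psi z| <= 1.
  apply: psi1 => f Af; have -> : pair f z = Phi (P f).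
    by rewrite PhiE (lf_sum _ _ (lp f)); apply: eq_bigr => i _; rewrite mulrC.
  by apply: PhiW; exists f.
have -> : psi z = Phi x0.
  by rewrite PhiE (lf_sum _ _ lpsi); apply: eq_bigr => i _; rewrite mulrC.
by move=> /(lt_le_trans Phi0); rewrite ltxx.
Qed.

(** All finite approximations of [psi] come from one compact disc [A]; an ultrafilter refining them
    converges in [A] to an element that agrees with [psi] at every [y]. *)
Lemma beta_dual psi : linear_functional psi -> continuous_functional beta psi ->
  exists f, pair f = psi.
Proof.
move=> lpsi cpsi.
have [S bS Spsi] := beta_unit (lcH_functional_ball beta_lcH lpsi cpsi ltr01).
(* The point 0 is adjoined so that [A] contains it even when [S] is empty. *)
have [A [SA cA bA coA]] := bbc (bounded_inU bS (bounded_in1 lcN 0)).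
have psi1 y : (forall f, A f -> `|pair f y| <= 1) -> `|psi y| <= 1.
  by move=> Ay; rewrite ltW //; apply: Spsi => f Sf; apply: Ay; apply: SA; left.
have A0 : A 0 by apply: SA; right.
pose close (p : set Y * K) :=
  A `&` [set f | forall y, p.1 y -> `|pair f y - psi y| <= p.2].
pose D := [set p : set Y * K | finite_set p.1 /\ 0 < p.2].
have PF : ProperFilter (filter_from D close).
  apply: filter_from_proper; first apply: filter_from_filter.
  - by exists (set0, 1); split=> //; exact: finite_set0.
  - move=> [T d] [T' d'] [/= fT d0] [/= fT' d'0].
    have [c [c0 cd cd']] := pos_common_lb d0 d'0.
    exists (T `|` T', c); first by split=> //; rewrite finite_setU.
    move=> f [Af /= Hf]; split; split=> //= y Ty.
      by apply: le_trans (Hf y _) cd; left.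
    by apply: le_trans (Hf y _) cd'; right.
  - move=> [T d] [/= fT d0].
    by have [f Af Hf] := finite_approximation lpsi cA A0 psi1 fT d0; exists f.
have [G [UG FG]] := ultraFilterLemma PF.
have [|a Aa Ga] := bounded_compact_limit bA coA UG.
  by apply: FG; exists (set0, 1); [split=> //; exact: finite_set0|move=> f []].
exists a; apply/funext => y; apply/eqP; rewrite -subr_eq0; apply/eqP.
apply: normr_small_eq0 => e e0; have e2 : 0 < e / 2 by rewrite divr_gt0.
have /filter_ex[f [[_ /= fpsi] /= fa]] : G (close ([set y], e / 2) `&`
    [set f | `|pair f y - pair a y| < e / 2]).
  apply: filterI; last exact: Ga.
  by apply: FG; exists ([set y], e / 2) => //; split=> //; exact: finite_set1.
rewrite [e]splitr -(subrKA (pair f y)) (le_trans (ler_normD _ _)) // lerD //.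
  by rewrite distrC ltW.
exact: fpsi.
Qed.

Lemma continuous_in_FBdual phi : linear_functional phi ->
  continuous_functional Nt phi -> in_FBdual N Nt phi.
Proof.
move=> lphi cphi; split=> // B bB f Bf e e0.
by have [U NU Ue] := cphi f e e0; exists U => // g _; exact: Ue.
Qed.

(** A functional separating [f] from [W] is [Nt]-continuous on all of F, hence on bounded sets, and
    so belongs to the predual. *)
Lemma closed_bipolar (W : set V) f : absconvex W -> N W -> closed_in Nt W ->
  (forall y, polar_in pair W 1 y -> `|pair f y| <= 1) -> W f.
Proof.
move=> cW NW clW Hf; apply: contrapT => nWf.
have [phi [lphi cphi phiW phif]] :=
  closed_separation KS lcNt cW (lcH0 lcN NW) clW nWf.
have [y yphi] := FB_mk lcNt (continuous_in_FBdual lphi cphi).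
have /(lt_le_trans phif) : `|phi f| <= 1.
  by rewrite -yphi; apply: Hf => g Wg; rewrite -[pair g y]/(pair^~ y g) yphi phiW.
by rewrite ltxx.
Qed.

Lemma polar_nbhd_bounded W : N W -> bounded_in beta (polar_in pair W 1).
Proof.
move=> NW; apply: polar_top_bounded => // S bS.
have [M M0 SM] := absorbs_polar_bounded (bS W NW).
by exists M => // f y Sf Wy; exact: (SM (pair^~ y)).
Qed.

Lemma beta_strong : bornological N -> forall U, N U <->
  exists2 B, bounded_in beta B &
    [set f | forall y, B y -> `|pair f y| <= 1] `<=` U.
Proof.
move=> bornN U; split=> [NU|[B bB BU]].
  have [W [NW WU cW clW]] := cnc NU.
  exists (polar_in pair W 1); first exact: polar_nbhd_bounded.
  by move=> f Hf; apply: WU; exact: (closed_bipolar cW NW clW Hf).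
(* Here [bornological] enters: the polar of [B] absorbs each bounded [S], as the polar of [S] is a
   [beta]-neighbourhood and absorbs [B]. *)
apply: (lcHS lcN BU); apply: bornN.
  exact: (polar_absconvex (S := B) (e := 1) lpl).
move=> S bS.
have [M M0 BM] := absorbs_polar_bounded (bB _ (polar_top_in pair bS ltr01)).
apply: (absorbs_polar lpl M0 ltr01) => y f By Sf.
by apply: (BM (pair f)) => // z; apply.
Qed.

(** The ultrafilter only supplies the limit values [psi]. The Cauchy property makes the convergence
    of [G] itself uniform on bounded sets, which preserves [Nt]-continuity there. *)
Lemma beta_complete : complete_lc beta.
Proof.
move=> G [[GT G0 GI GS] Gc].
have PG : ProperFilter G.
  by split=> //; split=> // A B AB GA; exact: GS GA AB.
have [G' [UG' GG']] := ultraFilterLemma PG.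
have Gcauchy B e : bounded_in N B -> 0 < e ->
    exists2 A, G A & forall u v, A u -> A v -> forall f, B f ->
      `|pair f u - pair f v| <= e.
  move=> bB e0; have [A GA AU] := Gc _ (polar_top_in pair bB e0).
  by exists A => // u v Au Av f Bf; rewrite -(lfB (lp f)); exact: AU.
have /choice[psi hpsi] : forall f, exists l,
    forall e, 0 < e -> G' [set u | `|pair f u - l| < e].
  move=> f; have [A GA Af] := Gcauchy _ _ (bounded_in1 lcN f) ltr01.
  have /filter_ex[u0 Au0] := GA.
  apply: (@scal_ultra _ _ _ KS _ _ _ (`|pair f u0| + 1)).
  apply: filterS (GG' _ GA) => u Au /=.
  rewrite -(subrK (pair f u0) (pair f u)) addrC (le_trans (ler_normD _ _)) //.
  by rewrite lerD2l; exact: Af.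
have Gunif B e : bounded_in N B -> 0 < e ->
    exists2 A, G A & forall u, A u -> forall f, B f -> `|pair f u - psi f| <= e.
  move=> bB e0; have e2 : 0 < e / 2 by rewrite divr_gt0.
  have [A GA AB] := Gcauchy _ _ bB e2; exists A => // u Au f Bf.
  have /filter_ex[v [Av /= vf]] :
      G' (A `&` [set v | `|pair f v - psi f| < e / 2]).
    by apply: filterI; [exact: GG'|exact: hpsi].
  rewrite [e]splitr -(subrKA (pair f v)) (le_trans (ler_normD _ _)) // lerD //.
    exact: AB.
  exact: ltW.
have psiFB : in_FBdual N Nt psi.
  split.
    exact: (@pointwise_limit_linear _ _ _ G' _ (fun u f => pair f u) _ hpsi).
  move=> B bB f Bf e e0; have e3 : 0 < e / 3 by rewrite divr_gt0.
  have [A /filter_ex[u Au] Apsi] := Gunif _ _ bB e3.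
  have [U NU Uu] := (FB_in_FBdual u).2 B bB f Bf _ e3.
  exists U => // g Bg Ug.
  have -> : psi g - psi f =
      (psi g - pair g u) + ((pair g u - pair f u) + (pair f u - psi f)) by ring.
  have -> : e = e / 3 + (e / 3 + e / 3) by field.
  apply: le_lt_trans (ler_normD _ _) _; apply: ler_ltD.
    by rewrite distrC Apsi.
  apply: le_lt_trans (ler_normD _ _) _; apply: ltr_leD; first exact: Uu.
  exact: Apsi.
have [y ypsi] := FB_mk lcNt psiFB.
exists y => U [S [e [bS e0 SU]]]; have [A GA Apsi] := Gunif _ _ bS e0.
apply: GS GA _ => u Au; apply: SU => f Sf.
by rewrite lfB // -[X in _ - X]/(pair^~ y f) ypsi; exact: Apsi.
Qed.

(** The polar of [W] is a Banach disc: the partial sums are [beta]-Cauchy because [W] absorbs every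
    bounded set, and the geometric bound on [W] passes to the limit pointwise. *)
Lemma polar_series W (u : nat -> Y) : N W ->
  (forall n, scale_set (3^-1 ^+ n.+1) (polar_in pair W 1) (u n.+1 - u n)) ->
  exists v, forall n, scale_set (3^-1 ^+ n / 2) (polar_in pair W 1) (v - u n).
Proof.
move=> NW du; pose p n : K := 3^-1 ^+ n.
have p0 n : 0 < p n by rewrite exprn_gt0.
have pS n : p n.+1 = p n / 3 by rewrite /p exprSr.
have step n f : W f -> `|pair f (u n.+1) - pair f (u n)| <= p n.+1.
  move=> Wf; have [y Wy yu] := du n.
  rewrite -(lfB (lp f)) -yu (lfZ (lp f)) normrM.
  by rewrite gtr0_norm // ger_pMr //; exact: Wy.
(* The subtracted term lets the induction close: the bound is the exact sum of the steps from [n] to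
   [n + m]. *)
have close n m f : W f ->
    `|pair f (u (n + m)%N) - pair f (u n)| <= p n / 2 - p (n + m)%N / 2.
  move=> Wf; elim: m => [|m IH]; first by rewrite addn0 !subrr normr0.
  rewrite addnS -(subrKA (pair f (u (n + m)%N))) (le_trans (ler_normD _ _)) //.
  apply: le_trans (lerD (step _ _ Wf) IH) _; rewrite pS -subr_ge0.
  have -> : p n / 2 - p (n + m)%N / 3 / 2 -
      (p (n + m)%N / 3 + (p n / 2 - p (n + m)%N / 2)) = 0 by field.
  by [].
have {}close n m f : W f -> (n <= m)%N ->
    `|pair f (u m) - pair f (u n)| <= p n / 2.
  move=> Wf /subnKC <-; apply: le_trans (close _ _ _ Wf) _.
  by rewrite gerBl divr_ge0 // ltW.
pose G := [set A : set Y | exists n, forall m, (n <= m)%N -> A (u m)].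
have GG : proper_filter G.
  split=> [||A B [n An] [m Bm]|A B [n An] AB].
  - by exists 0%N.
  - by case=> n /(_ n (leqnn n)).
  - exists (maxn n m) => k; rewrite geq_max => /andP[nk mk].
    by split; [exact: An|exact: Bm].
  - by exists n => m nm; apply/AB/An.
have [|v vG] := @beta_complete G.
  split=> // U [S [e [bS e0 SU]]].
  have [M M0 SM] := absorbs_polar_bounded (bS W NW).
  have [n ne] := scalar_expV_small KS M0 e0.
  exists [set y | exists2 m, (n <= m)%N & y = u m].
    by exists n => m nm; exists m.
  move=> _ _ [k nk ->] [m nm ->]; apply: SU => f Sf; apply: le_trans ne.
  have pn : p n != 0 by rewrite gt_eqF.
  have E : pair f (u k - u m) = p n * pair f ((p n)^-1 *: (u k - u m)).
    by rewrite (lfZ (lp f)) mulrA divff // mul1r.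
  rewrite E normrM (gtr0_norm (p0 n)) ler_wpM2l ?(ltW (p0 n)) //.
  apply: (SM (pair^~ ((p n)^-1 *: (u k - u m)))) => // g Wg.
  rewrite (lfZ (lp g)) normrM normfV (gtr0_norm (p0 n)) ler_pdivrMl // mulr1.
  rewrite (lfB (lp g)) -(subrKA (pair g (u n))) (le_trans (ler_normD _ _)) //.
  by rewrite [leRHS]splitr lerD // ?[`|pair g (u n) - _|]distrC close.
exists v => n.
have p2 : 0 < p n / 2 by rewrite divr_gt0.
apply/scale_setP; first by rewrite gt_eqF.
move=> f Wf.
rewrite (lfZ (lp f)) normrM normfV (gtr0_norm p2) ler_pdivrMl // mulr1.
rewrite (lfB (lp f)); apply: contrapT => /(normr_nle (ltW p2)) far.
pose d := `|pair f v - pair f (u n)| - p n / 2.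
have d0 : 0 < d by rewrite subr_gt0.
have d2 : 0 < d / 2 by rewrite divr_gt0.
have [m /(_ (maxn m n) (leq_maxl _ _)) um] :=
  vG _ (polar_top_in pair (bounded_in1 lcN f) d2).
have cl := close n (maxn m n) f Wf (leq_maxr _ _).
suff : p n / 2 < p n / 2 by rewrite ltxx.
apply: lt_le_trans cl; apply: (@normr_lt_near _ (pair f v - pair f (u n))).
rewrite -/d opprB addrA subrK -(lfB (lp f)); apply: le_lt_trans (um f erefl) _.
by rewrite ltr_pdivrMr // mulr_natr mulr2n ltrDl.
Qed.

Lemma beta_barrelled : barrelled beta.
Proof.
move=> D cD aD clD; pose pairl (y : Y) (f : V) := pair f y.
pose B := polar_in pairl D 1.
have D0 : D 0.
  have /absorbsP[r r0 Dr] := aD 0.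
  by rewrite -(scaler0 _ r); apply: Dr; rewrite ?gtr0_norm.
have bB : bounded_in N B.
  move=> U /cnc[W [NW WU cW clW]]; apply: absorbsS WU _.
  have [||y||M M0 BM] := gliding_hump KS (S := B) (E := polar_in pair W 1) lp.
  - exact: polar_absconvex.
  - move=> f _; have [M M0 fM] := absorbs_polar_bounded (lcH_absorbing lcN NW f).
    by exists M => // y Wy; exact: (fM (pair^~ y)).
  - have [M M0 yM] := absorbs_polar_bounded (aD y).
    by exists M => // f Bf; apply: (yM (pair f)).
  - by move=> u; exact: polar_series.
  (* Being bounded by [M] on the polar of [W], the set [B] shrunk by [M^-1] lies in the bipolar of
     [W], which is [W]. *)
  apply/absorbsP; exists M^-1; first by rewrite invr_gt0.
  move=> a _ aM f Bf; apply: closed_bipolar => // y Wy.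
  rewrite (lfZ (lpl y)) normrM -(mulVf (lt0r_neq0 M0)).
  by apply: ler_pM => //; exact: BM.
exists B, 1; split=> // y By; apply: contrapT => nDy.
(* The bipolar argument in the predual: the separating functional is represented by some [f], which
   lies in [B] since it is at most 1 on [D]. *)
have [phi [lphi cphi phiD phiy]] := closed_separation KS beta_lcH cD D0 clD nDy.
have [f fphi] := beta_dual lphi cphi.
have /By : B f by move=> z Dz; rewrite /pairl fphi; exact: phiD.
by rewrite fphi => /(lt_le_trans phiy); rewrite ltxx.
Qed.

End StrongDual.

(** * The equivalences over both scalar fields *)

Lemma dual_linearisation (R : realType) (K : numFieldType)
    (j : {rmorphism R -> K}) (Omega : topologicalType) (V : lmodType K)
    (ev : V -> Omega -> K) (N Nt : set (set V)) :
  scalar_field j ->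
  (forall (a : K) f g x, ev (a *: f + g) x = a * ev f x + ev g x) ->
  injective ev -> lcH_top N -> bornological N -> lcH_top Nt ->
  BBC N Nt -> CNC N Nt -> (forall x, in_FBdual N Nt (fun f => ev f x)) ->
  Delta_beta_continuous ev N -> has_cont_strong_cb_linearisation ev N.
Proof.
move=> KS evl evI lcN bornN lcNt bbc cnc evFB Dcont.
have /choice[delta deltaE] := fun x => FB_mk lcNt (evFB x).
have deltaP f x : pairing f (delta x) = ev f x.
  exact: (congr1 (@^~ f) (deltaE x)).
exists (FB N lcNt), (polar_top (@pairing K V N Nt lcNt) (bounded_in N)), delta,
  (@pairing K V N Nt lcNt); split.
- exact: beta_lcH.
- by move=> f; split; [exact: pairing_linear | exact: pairing_continuous].
- by move=> a f g; apply/funext => y; exact: pairing_linearl.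
- move=> f g fg; apply: evI; apply/funext => x.
  by rewrite -!deltaP fg.
- split=> //.
  + by move=> phi lphi cphi; exact: (beta_dual KS).
  + exact: (beta_strong KS).
  + by split; [exact: (beta_complete KS) | exact: (beta_barrelled KS)].
  + move=> x U [S [e [bS e0 SU]]].
    apply: filterS (Dcont x S bS e e0) => z Hz; apply: SU => f Sf.
    by rewrite (lfB (pairing_linear f)) !deltaP; exact: Hz.
Qed.

Lemma Thm4p10_scalar_field (R : realType) (K : numFieldType)
  (j : {rmorphism R -> K}) : scalar_field j -> Thm4p10_for K.
Proof.
move=> KS Omega _ _ V ev evl evI evc N lcN bornN Sa Sb Sc Sd.
have ab : Sa -> Sb by exact: (linearisation_equicontinuous KS).
have bc : Sb -> Sc.
  move=> [Nt [lcNt fine bbc cnc eqc]]; exists Nt.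
  by have [? ?] := equicontinuous_Delta evl fine eqc.
have ca : Sc -> Sa.
  move=> [Nt [lcNt bbc cnc evFB Dc]].
  exact: (dual_linearisation KS evl evI lcN bornN lcNt).
split; [by split=> // /bc | by split=> // /ca |].
(* (d) is reduced to (b): singletons are compact, so the compact-open condition contains the
   pointwise one. *)
move=> gk [Nt [lcNt fine bbc cnc]]; apply: bc; exists Nt; split=> //.
- move=> x e e0; apply: lcHS (fine [set x] (@compact_set1 _ x) e e0) => //.
  by move=> f; exact.
- exact: (gkR_equicontinuous KS evl evc gk lcNt fine bbc).
Qed.

(* K = R and K = C (= R[i]) *)
Theorem theorem4p10 (R : realType) : Thm4p10_for R /\ Thm4p10_for R[i].
Proof.
split; first exact: (Thm4p10_scalar_field (scalar_field_real R)).
exact: (Thm4p10_scalar_field (scalar_field_complex R)).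
Qed.
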